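(* Let $C$ be a binary linear code with Tanner graph $T$, let $\widehat T$ be a bit-even Tanner graph obtained by duplicating some or all of the check nodes of $T$, and let $\widehat C$ be the cycle code on $\widehat T$. Then $C$ is a punctured subcode of $\widehat C$; that is, $C$ is obtained from a linear subcode of $\widehat C$ by deleting a fixed set of coordinates. Moreover, let $x_1,\dots,x_n$ be the bit nodes and let $d_i$ be the (even) degree of the $i$-th bit node of $\widehat T$. After choosing a suitable labeling of the $\sum_{i=1}^n d_i$ edges of $\widehat T$ (namely, one in which the edges incident to $x_i$ are $e_{(i,1)},\dots,e_{(i,d_i)}$, with corresponding indeterminates $u_{(i,1)},\dots,u_{(i,d_i)}$), the unscaled pseudo-codewords of $C$ with respect to $T$ are precisely those vectors $(p_1,\dots,p_n)$ of nonnegative integers such that $$\prod_{1\le i\le n,\ 1\le j\le d_i}u_{(i,j)}^{p_i}$$ appears with nonzero coefficient in the power series expansion of the edge zeta function $\zeta_{\widehat T}$ of $\widehat T$.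
   Context: Tanner graphs: a binary linear code of length $n$ is a subspace $C\subseteq\mathbb F_2^n$. For an $r\times n$ $0/1$ matrix $H=(h_{ji})$, the Tanner graph $T(H)$ is the bipartite graph with bit nodes $x_1,\dots,x_n$ and check nodes $f_1,\dots,f_r$, where $\{x_i,f_j\}$ is an edge iff $h_{ji}=1$. ''$C$ has Tanner graph $T$'' means $T=T(H)$ for a chosen $H$ with $C=\{\mathbf c\in\mathbb F_2^n: H\mathbf c^{\mathsf T}=\mathbf 0\}$; equivalently, a binary assignment to the bit nodes is in $C$ iff at each check node the values at the neighboring bit nodes sum to $0$ mod $2$. A Tanner graph is bit-even if every bit node in it has even degree. Duplicating a check node $f$ means adding a new check node with the same neighboring bit nodes as $f$ (equivalently, repeating the corresponding row of $H$). Graphs are undirected, and bipartite graphs have no multiple edges. Covers and pseudo-codewords: write $\partial(v)$ for the set of neighbors of $v$. A cover of a graph $G=(V,E)$ is a graph $\widetilde G=(\widetilde V,\widetilde E)$ with a surjective graph homomorphism $\pi:\widetilde V\to V$ such that for each $v\in V$ and each $\tilde v\in\pi^{-1}(v)$, $\partial(\tilde v)$ is mapped bijectively to $\partial(v)$; it is an $M$-cover ($M$ a positive integer) if $|\pi^{-1}(v)|=M$ for all $v\in V$. An $M$-cover $\widetilde T$ of $T$ is again a Tanner graph, with bit nodes $x_{(i,k)}$, $1\le k\le M$, lying over $x_i$, and check nodes those lying over the check nodes of $T$; it determines a code $\widetilde C\subseteq\mathbb F_2^{nM}$. The unscaled pseudo-codeword corresponding to $\tilde{\mathbf a}=(a_{(i,k)})\in\widetilde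 C$ is $(p_1,\dots,p_n)$, where $p_i$ is the number of $k$ with $a_{(i,k)}\ne0$. The unscaled pseudo-codewords of $C$ with respect to $T$ are all vectors arising in this way from $M$-covers of $T$, $M\ge1$. Paths and cycles: in a graph with edges $e_1,\dots,e_m$, a sequence of edges $(e_{i_1},\dots,e_{i_k})$ is a path if the edges can be directed so that $e_{i_s}$ terminates where $e_{i_{s+1}}$ begins for $1\le s\le k-1$; it is a cycle if moreover $e_{i_k}$ terminates where $e_{i_1}$ begins. It is backtrackless if for no $s$ do we have $e_{i_s}=e_{i_{s+1}}$. A cycle is tailless if $e_{i_1}\ne e_{i_k}$; edge-simple if its edges are pairwise distinct; simple if each vertex is involved in at most two of its edges (simple cycles being edge-simple); primitive if it is not $\Theta^r$ (a cycle $\Theta$ followed $r$ times) for any cycle $\Theta$ and any $r\ge2$. Two cycles of length $k$ are equivalent if their edge sequences differ by a cyclic shift of indices modulo $k$. Cycle code on a graph $G$ with $m$ edges: the subspace of $\mathbb F_2^m$ spanned by the characteristic vectors (indicator vectors of edge sets) of the simple cycles in $G$. Edge zeta function: for a path $\Gamma=(e_{i_1},\dots,e_{i_k})$ set $g(\Gamma)=u_{i_1}\cdots u_{i_k}$, where $u_1,\dots,u_m$ are indeterminates. The edge zeta function of a graph $G$ with $m$ edges is $\zeta_G(u_1,\dots,u_m)=\prod_{[\Gamma]\in A(G)}(1-g(\Gamma))^{-1}\in\mathbb Z[[u_1,\dots,u_m]]$, where $A(G)$ is the collection of equivalence classes of backtrackless, tailless, primitive cycles in $G$.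
   Formalization: The first assertion (C is a punctured subcode of the cycle code) is proved assuming no bit node of the bit-even Tanner graph has degree 0; it fails, e.g., for n = 1 with no check nodes. The pseudo-codeword assertion carries no such restriction. *)

(* Defs.v *)
From HB Require Import structures.
From mathcomp Require Import all_boot all_order all_algebra.
From mathcomp Require Import boolp.

Set Implicit Arguments.
Unset Strict Implicit.
Unset Printing Implicit Defensive.

Import GRing.Theory.
Local Open Scope ring_scope.

(* A monomial is its exponent vector, so a product of monomials is written as a
   sum: the monomial u_e is [mvar e], and u_e ^ k is [mvar e *+ k]. *)
Notation monom E := {ffun E -> nat}.

Definition mvar (E : finType) (e : E) : monom E := [ffun e' => (e' == e) : nat].

Definition mdegree (E : finType) (m : monom E) : nat := (\sum_e m e)%N.

Definition mdvd (E : finType) (a m : monom E) : bool := [forall e, (a e <= m e)%N].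

Definition msub (E : finType) (m a : monom E) : monom E :=
  [ffun e => (m e - a e)%N].

(* The exponents of a divisor of [m] are bounded by the degree of [m]. *)
Definition mdivisors (E : finType) (m : monom E) : seq (monom E) :=
  [seq a <- [seq [ffun e => b e : nat] | b : {ffun E -> 'I_(mdegree m).+1}]
  | mdvd a m].

Definition mpseries (R : comNzRingType) (E : finType) : Type := monom E -> R.

Section MonomialTheory.
Variable E : finType.
Implicit Types a b c m : monom E.

Lemma maddE a b e : (a + b) e = (a e + b e)%N.
Proof. by rewrite ffunE. Qed.

Lemma mdvdP a m : reflect (forall e, (a e <= m e)%N) (mdvd a m).
Proof. exact: forallP. Qed.

Lemma mem_mdivisors a m : (a \in mdivisors m) = mdvd a m.
Proof.
rewrite mem_filter; apply: andb_idr => /mdvdP am; apply/imageP.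
have lt_a e : (a e < (mdegree m).+1)%N.
  by rewrite ltnS (leq_trans (am e)) // /mdegree (bigD1 e) //= leq_addr.
exists [ffun e => Ordinal (lt_a e)] => //.
by apply/ffunP=> e; rewrite !ffunE.
Qed.

Lemma mdivisors_uniq m : uniq (mdivisors m).
Proof.
apply: filter_uniq; rewrite map_inj_uniq ?enum_uniq // => b c /ffunP eq_bc.
by apply/ffunP=> e; apply: val_inj; have := eq_bc e; rewrite !ffunE.
Qed.

Lemma msubK a m : mdvd a m -> msub m a + a = m.
Proof. by move/mdvdP=> am; apply/ffunP=> e; rewrite maddE ffunE subnK. Qed.

Lemma maddK a b : msub (a + b) b = a.
Proof. by apply/ffunP=> e; rewrite ffunE maddE addnK. Qed.

Lemma maddKl a b : msub (a + b) a = b.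
Proof. by rewrite addrC maddK. Qed.

Lemma mdvd_addr a b : mdvd b (a + b).
Proof. by apply/mdvdP=> e; rewrite maddE leq_addl. Qed.

Lemma msubKK a m : mdvd a m -> msub m (msub m a) = a.
Proof.
by move=> /mdvdP am; apply/ffunP=> e; rewrite !ffunE subKn.
Qed.

Lemma msub_mdvd a m : mdvd (msub m a) m.
Proof. by apply/mdvdP=> e; rewrite ffunE leq_subr. Qed.

Lemma mdvd_addl a b : mdvd a (a + b).
Proof. by rewrite addrC mdvd_addr. Qed.

Lemma mdvd0 a : mdvd 0 a.
Proof. by apply/mdvdP=> e; rewrite !ffunE. Qed.

Lemma mdvdn0 a : mdvd a 0 = (a == 0).
Proof.
apply/idP/eqP => [/mdvdP a0 | ->]; last exact: mdvd0.
by apply/ffunP=> e; have := a0 e; rewrite !ffunE leqn0 => /eqP.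
Qed.

Lemma mdvd_trans a b c : mdvd a b -> mdvd b c -> mdvd a c.
Proof.
by move=> /mdvdP ab /mdvdP bc; apply/mdvdP=> e; apply: leq_trans (bc e).
Qed.

Lemma mdegreeD a b : mdegree (a + b) = (mdegree a + mdegree b)%N.
Proof.
rewrite /mdegree -big_split /=.
by apply: eq_bigr => e _; rewrite maddE.
Qed.

Lemma mdegree_mvar (e : E) : mdegree (mvar e) = 1%N.
Proof.
rewrite /mdegree (bigD1 e) //= ffunE eqxx big1 // => i /negbTE.
by rewrite ffunE => ->.
Qed.

Lemma mdvd_leq a b : mdvd a b -> (mdegree a <= mdegree b)%N.
Proof. by move/msubK=> <-; rewrite mdegreeD leq_addl. Qed.

Lemma mdegree_eq0 a : (mdegree a == 0%N) = (a == 0).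
Proof.
apply/eqP/eqP => [a0 | ->]; last by rewrite /mdegree big1 // => e _; rewrite ffunE.
apply/ffunP=> e; rewrite ffunE; apply/eqP.
by rewrite -leqn0 -a0 /mdegree (bigD1 e) //= leq_addr.
Qed.

End MonomialTheory.

Section SeriesRing.
Variables (R : comNzRingType) (E : finType).
Local Notation S := (mpseries R E).
Implicit Types x y z : S.

HB.instance Definition _ := gen_eqMixin S.
HB.instance Definition _ := gen_choiceMixin S.

Definition mps_zero : S := fun=> 0.
Definition mps_one : S := fun m => (m == 0)%:R.
Definition mps_opp x : S := fun m => - x m.
Definition mps_add x y : S := fun m => x m + y m.
Definition mps_mul x y : S :=
  fun m => \sum_(a <- mdivisors m) x a * y (msub m a).

Lemma mps_addA : associative mps_add.
Proof. by move=> x y z; apply/funext=> m; apply: addrA. Qed.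
Lemma mps_addC : commutative mps_add.
Proof. by move=> x y; apply/funext=> m; apply: addrC. Qed.
Lemma mps_add0 : left_id mps_zero mps_add.
Proof. by move=> x; apply/funext=> m; apply: add0r. Qed.
Lemma mps_addN : left_inverse mps_zero mps_opp mps_add.
Proof. by move=> x; apply/funext=> m; apply: addNr. Qed.

HB.instance Definition _ :=
  GRing.isZmodule.Build S mps_addA mps_addC mps_add0 mps_addN.

Lemma mps_mulC : commutative mps_mul.
Proof.
move=> x y; apply/funext=> m; rewrite /mps_mul.
have perm : perm_eq (mdivisors m) [seq msub m a | a <- mdivisors m].
  apply: uniq_perm; first exact: mdivisors_uniq.
    rewrite map_inj_in_uniq ?mdivisors_uniq // => a b.
    rewrite !mem_mdivisors => am bm /(congr1 (fun c => msub m c)).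
    by rewrite !msubKK.
  move=> a; rewrite mem_mdivisors; apply/idP/mapP => [am | [b _ ->]].
    by exists (msub m a); rewrite ?mem_mdivisors ?msub_mdvd ?msubKK.
  exact: msub_mdvd.
rewrite (perm_big _ perm) big_map; apply: eq_big_seq => a.
by rewrite mem_mdivisors => am; rewrite mulrC msubKK.
Qed.

Lemma mps_mulA : associative mps_mul.
Proof.
move=> x y z; apply/funext=> m; rewrite /mps_mul.
transitivity (\sum_(a <- mdivisors m) \sum_(c <- mdivisors m | mdvd a c)
                x a * y (msub c a) * z (msub m c)).
  apply: eq_big_seq => a; rewrite mem_mdivisors => am.
  rewrite mulr_sumr -[RHS]big_filter.
  have perm : perm_eq [seq c <- mdivisors m | mdvd a c]
                      [seq b + a | b <- mdivisors (msub m a)].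
    apply: uniq_perm; first by rewrite filter_uniq ?mdivisors_uniq.
      by rewrite map_inj_uniq ?mdivisors_uniq // => b c /(congr1 (@msub _ ^~ a));
        rewrite !maddK.
    move=> c; rewrite mem_filter mem_mdivisors.
    apply/andP/mapP => [[ac cm] | [b]].
      exists (msub c a); last by rewrite msubK.
      rewrite mem_mdivisors; apply/mdvdP=> e; rewrite !ffunE leq_sub2r //.
      exact/mdvdP.
    rewrite mem_mdivisors => /mdvdP bm ->; split; first exact: mdvd_addr.
    rewrite -(msubK am); apply/mdvdP=> e.
    by move: (bm e); rewrite !maddE leq_add2r.
  rewrite (perm_big _ perm) big_map; apply: eq_bigr => b _.
  rewrite maddK mulrA; congr (_ * z _).
  by apply/ffunP=> e; rewrite [LHS]ffunE [RHS]ffunE ffunE maddE addnC subnDA.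
rewrite (exchange_big_dep xpredT) //=.
apply: eq_big_seq => c; rewrite mem_mdivisors => cm.
rewrite mulr_suml -big_filter; apply: perm_big.
apply: uniq_perm; [exact/filter_uniq/mdivisors_uniq | exact: mdivisors_uniq |].
move=> a.
rewrite mem_filter !mem_mdivisors; apply: andb_idr => ac.
exact: mdvd_trans cm.
Qed.

Lemma mps_mul1 : left_id mps_one mps_mul.
Proof.
move=> x; apply/funext=> m; rewrite /mps_mul (bigD1_seq 0) ?mdivisors_uniq //=.
  rewrite /mps_one eqxx mul1r big1 ?addr0 => [|a /negbTE->]; last exact: mul0r.
  by congr (x _); rewrite -{1}[m]addr0 maddK.
by rewrite mem_mdivisors mdvd0.
Qed.

Lemma mps_mulD : left_distributive mps_mul mps_add.
Proof.
move=> x y z; apply/funext=> m; rewrite /mps_mul /mps_add -big_split /=.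
by apply: eq_bigr => a _; rewrite mulrDl.
Qed.

Lemma mps_one_neq0 : mps_one != 0.
Proof.
apply/eqP=> /(congr1 (fun x : S => x 0)) /eqP.
by rewrite /mps_one eqxx oner_eq0.
Qed.

HB.instance Definition _ := GRing.Zmodule_isComNzRing.Build S
  mps_mulA mps_mulC mps_mul1 mps_mulD mps_one_neq0.

(* Inverses are unique, the ring being commutative; see [mps_geom_unit] for the
   invertibility of 1 - g. *)
Definition mps_unit : {pred S} := fun x => `[< exists y, y * x = 1 >].

Definition mps_inv x : S :=
  if pselect (exists y, y * x = 1) is left ex then sval (cid ex) else x.

Lemma mps_mulV : {in mps_unit, left_inverse 1 mps_inv *%R}.
Proof.
move=> x /asboolP ux; rewrite /mps_inv.
by case: pselect => // ex; case: cid.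
Qed.

Lemma mps_unitP x y : y * x = 1 -> mps_unit x.
Proof. by move=> yx; apply/asboolP; exists y. Qed.

Lemma mps_inv_out : {in [predC mps_unit], mps_inv =1 id}.
Proof.
move=> x /asboolP nux; rewrite /mps_inv.
by case: pselect.
Qed.

HB.instance Definition _ := GRing.ComNzRing_hasMulInverse.Build S
  mps_mulV mps_unitP mps_inv_out.

Definition mpsX (a : monom E) : S := fun m => (m == a)%:R.

Lemma mpsDE x y m : (x + y) m = x m + y m. Proof. by []. Qed.
Lemma mpsBE x y m : (x - y) m = x m - y m. Proof. by []. Qed.
Lemma mps1E m : (1 : S) m = (m == 0)%:R. Proof. by []. Qed.
Lemma mpsME x y m : (x * y) m = \sum_(a <- mdivisors m) x a * y (msub m a).
Proof. by []. Qed.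

Lemma mpsMXE x a m : (x * mpsX a) m = if mdvd a m then x (msub m a) else 0.
Proof.
rewrite mulrC mpsME; case: ifP => [am | /negbT am].
  rewrite (bigD1_seq a) ?mdivisors_uniq ?mem_mdivisors //=.
  rewrite /mpsX eqxx mul1r big1 ?addr0 // => b /negbTE->; exact: mul0r.
rewrite big_seq big1 // => b; rewrite mem_mdivisors /mpsX.
by case: eqP => [-> | _ _]; rewrite ?(negbTE am) ?mul0r.
Qed.

Lemma mps_geom_unit (a : monom E) : a != 0 -> 1 - mpsX a \is a GRing.unit.
Proof.
move=> a_n0; have a_gt0 : (0 < mdegree a)%N by rewrite lt0n mdegree_eq0.
pose y : S := fun m => (`[< exists k : nat, m = a *+ k >])%:R.
have y1 : y * (1 - mpsX a) = 1; last by apply/unitrPr; exists y; rewrite mulrC.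
rewrite mulrBr mulr1; apply/funext=> m; rewrite mpsBE mpsMXE mps1E /y.
case: ifPn => [am | nam]; last first.
  rewrite subr0; congr (nat_of_bool _)%:R; apply/asboolP/eqP.
    by case=> [[|k]] // mE; rewrite mE mulrSr mdvd_addr in nam.
  by move=> ->; exists 0%N.
have m_n0 : m == 0 = false.
  by apply/negP=> /eqP m0; rewrite m0 mdvdn0 (negbTE a_n0) in am.
rewrite m_n0; apply/eqP; rewrite subr_eq0; apply/eqP; congr (nat_of_bool _)%:R.
apply/asboolP/asboolP=> [[[|k]] | [k]] mE.
- by rewrite mE mulr0n eqxx in m_n0.
- by exists k; rewrite mE mulrSr maddK.
by exists k.+1; rewrite mulrSr -mE msubK.
Qed.

Lemma mps_geomE (a m : monom E) : (mdegree m < mdegree a)%N ->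
  (1 - mpsX a)^-1 m = (m == 0)%:R.
Proof.
move=> lt_ma; have a_n0 : a != 0 by rewrite -mdegree_eq0 -lt0n (leq_trans _ lt_ma).
set x := _^-1; have : x * (1 - mpsX a) = 1 by rewrite mulVr ?mps_geom_unit.
rewrite mulrBr mulr1 => /(congr1 (fun z : S => z m)).
rewrite mpsBE mpsMXE ifN ?subr0 //.
by apply/negP=> /mdvd_leq; rewrite leqNgt lt_ma.
Qed.

End SeriesRing.

(* Finite undirected graphs with neither loops nor multiple edges; every graph
   considered here is bipartite or a cover of a bipartite graph. *)
Structure sgraph := SGraph {
  svertex :> finType;
  sadj : rel svertex;
  sadj_sym : symmetric sadj;
  sadj_irr : irreflexive sadj }.

Section Graph.
Variable G : sgraph.

Definition neighbors (v : G) : {set G} := [set w | sadj v w].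
Definition degree (v : G) : nat := #|neighbors v|.

Definition is_edge (e : {set G}) : bool :=
  [exists v, exists w, sadj v w && (e == [set v; w])].

Definition edge : finType := {e : {set G} | is_edge e}.
Definition ends (e : edge) : {set G} := sval e.

(* A directed edge is a pair (initial vertex, terminal vertex); [ds] is a choice
   of a direction for each occurrence of an edge in [s]. *)
Definition directs (ds : seq (G * G)) (s : seq edge) : Prop :=
  [seq [set d.1; d.2] | d <- ds] = [seq ends e | e <- s].

Definition consecutive (d d' : G * G) : bool := d.2 == d'.1.

(* [path.cycle] also relates the last directed edge to the first one. *)
Definition is_cycle (s : seq edge) : Prop :=
  s <> [::] /\ exists ds, directs ds s /\ path.cycle consecutive ds.

Definition backtrackless (s : seq edge) : bool :=
  sorted (fun e e' => e != e') s.

Definition tailless (s : seq edge) : bool :=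
  if s is e :: s' then e != last e s' else true.

(* The closed walk (e, e) meets the degree condition on vertices below, hence the
   explicit edge-simplicity in [simple_cycle]. *)
Definition edge_simple (s : seq edge) : bool := uniq s.

Definition simple_cycle (s : seq edge) : Prop :=
  [/\ is_cycle s, edge_simple s &
      forall v : G, (count (fun e => v \in ends e) s <= 2)%N].

Definition primitive (s : seq edge) : Prop :=
  ~ exists th r, [/\ is_cycle th, (2 <= r)%N & s = flatten (nseq r th)].

Definition charvec (A : {set edge}) : {ffun edge -> ('F_2)^o} :=
  [ffun e => (e \in A)%:R].

Definition cycle_code : {vspace {ffun edge -> ('F_2)^o}} :=
  span [seq charvec A | A <- enum {: {set edge}} &
       `[< exists s, simple_cycle s /\ A = [set e in s] >]].

Definition cyclic_shift k (s t : k.-tuple edge) : bool :=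
  [exists i : 'I_k, rot i s == t :> seq edge].

Definition zeta_cycles k : {set k.-tuple edge} :=
  [set t : k.-tuple edge | `[< [/\ is_cycle t, backtrackless t, tailless t
                                 & primitive t] >]].

Definition zeta_classes k : {set {set k.-tuple edge}} :=
  equivalence_partition (@cyclic_shift k) (zeta_cycles k).

Definition cycle_monom (s : seq edge) : monom edge := \sum_(e <- s) mvar e.

(* The product of (1 - g)^-1 over the classes of length at most N. The monomial
   g is the same for all members of a class, so one representative is picked in
   each class. *)
Definition partial_zeta (N : nat) : mpseries int edge :=
  \prod_(k < N.+1)
    \prod_(t in transversal (zeta_classes k) (zeta_cycles k))
      (1 - mpsX int (cycle_monom t))^-1.

(* The infinite product converges coefficientwise: by [partial_zeta_stable], the
   coefficient of m no longer changes once N reaches the degree of m. *)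
Definition edge_zeta : mpseries int edge :=
  fun m => partial_zeta (mdegree m) m.

Lemma mdegree_cycle_monom s : mdegree (cycle_monom s) = size s.
Proof.
rewrite /cycle_monom; elim: s => [|e s IHs]; last first.
  by rewrite big_cons mdegreeD mdegree_mvar IHs.
by rewrite big_nil; apply/eqP; rewrite mdegree_eq0.
Qed.

Lemma partial_zeta_stable N m :
  (mdegree m <= N)%N -> partial_zeta N m = edge_zeta m.
Proof.
pose low N (x : mpseries int edge) :=
  forall b, (mdegree b <= N)%N -> x b = (b == 0)%:R.
have mul_low M x y b : low M y -> (mdegree b <= M)%N -> (x * y) b = x b.
  move=> yM bM; rewrite mulrC -[x in RHS]mul1r !mpsME.
  rewrite big_seq [RHS]big_seq; apply: eq_bigr => a.
  by rewrite mem_mdivisors => /mdvd_leq ab; rewrite yM // (leq_trans ab).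
elim: N => [|N IHN]; first by rewrite leqn0 /edge_zeta => /eqP->.
rewrite leq_eqVlt => /predU1P[mN | ltmN]; first by rewrite /edge_zeta mN.
rewrite -IHN // /partial_zeta big_ord_recr /=.
apply: (mul_low N) => //.
apply: (big_ind (low N)) => [||t _].
- by move=> b _; rewrite mps1E.
- by move=> x y xN yN b bN; rewrite (mul_low N) // xN.
by move=> b bN; rewrite mps_geomE // mdegree_cycle_monom size_tuple ltnS.
Qed.

End Graph.

Definition is_cover (G Gt : sgraph) (pi : Gt -> G) : Prop :=
  [/\ forall v, exists vt, pi vt = v,
      forall vt wt, sadj vt wt -> sadj (pi vt) (pi wt) &
      forall vt, {in neighbors vt &, injective pi}
              /\ pi @: neighbors vt = neighbors (pi vt)].

Definition is_Mcover (M : nat) (G Gt : sgraph) (pi : Gt -> G) : Prop :=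
  is_cover pi /\ forall v, #|[set vt | pi vt == v]| = M.

Section Tanner.
Variables (n r : nat) (H : 'M['F_2]_(r, n)).

Definition tanner_adj : rel ('I_n + 'I_r) := fun u v =>
  match u, v with
  | inl i, inr j | inr j, inl i => H j i == 1
  | _, _ => false
  end.

Lemma tanner_adj_sym : symmetric tanner_adj.
Proof. by case=> u [] v. Qed.

Lemma tanner_adj_irr : irreflexive tanner_adj.
Proof. by case. Qed.

Definition tanner : sgraph := SGraph tanner_adj_sym tanner_adj_irr.

Definition bit_node (i : 'I_n) : tanner := inl i.

Definition is_bit (v : tanner) : bool := if v is inl _ then true else false.

Definition has_tanner_graph (C : {vspace 'rV['F_2]_n}) : Prop :=
  forall c, c \in C <-> H *m c^T = 0.

Definition bit_even : Prop := forall i, ~~ odd (degree (bit_node i)).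

(* The code of a cover consists of assignments to the nodes over bit nodes only;
   the remaining nodes are the checks. *)
Definition bit_over (Tt : sgraph) (pi : Tt -> tanner) : finType :=
  {x : Tt | is_bit (pi x)}.

Definition in_cover_code (Tt : sgraph) (pi : Tt -> tanner)
    (a : {ffun bit_over pi -> 'F_2}) : Prop :=
  forall ft : Tt, ~~ is_bit (pi ft) ->
    \sum_(x : bit_over pi | sadj ft (sval x)) a x = 0.

Definition unscaled_pseudocodeword (p : 'I_n -> nat) : Prop :=
  exists (M : nat) (Tt : sgraph) (pi : Tt -> tanner)
         (a : {ffun bit_over pi -> 'F_2}),
    [/\ (0 < M)%N, is_Mcover M pi, in_cover_code a &
        forall i, p i =
          #|[set x : bit_over pi | (pi (sval x) == bit_node i) && (a x != 0)]|].

(* [lab i j] is the edge e_(i,j): every edge has exactly one label (i, j), and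
   the edges labelled (i, _) are incident to the i-th bit node. *)
Definition bit_labeling
    (lab : forall i : 'I_n, 'I_(degree (bit_node i)) -> edge tanner) : Prop :=
  bijective (fun ij : {i : 'I_n & 'I_(degree (bit_node i))} =>
               lab (tag ij) (tagged ij))
  /\ forall i j, bit_node i \in ends (lab i j).

End Tanner.

(* The check nodes of H, together with [s] new ones, the [k]-th being a duplicate
   of the check node [f k]; a check node may be duplicated several times. *)
Definition duplicate_checks n r s (H : 'M['F_2]_(r, n)) (f : 'I_s -> 'I_r) :
  'M['F_2]_(r + s, n) := col_mx H (rowsub f H).

(* E indexes the coordinates of D, and [phi] lists the coordinates that are not deleted. *)
Definition punctured_subcode n (C : {vspace 'rV['F_2]_n}) (E : finType)
    (D : {vspace {ffun E -> ('F_2)^o}}) : Prop :=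
  exists (D' : {vspace {ffun E -> ('F_2)^o}}) (phi : 'I_n -> E),
    [/\ (D' <= D)%VS, injective phi &
        forall c, c \in C <->
          exists2 d, d \in D' & c = \row_(i < n) (d (phi i) : 'F_2)].

(* Main.v *)
(* For a vector p of nonnegative integers call a check balanced if the sum of p
   over its neighbors is an even number 2h and no p_i exceeds h there. Both sides
   of the equivalence say that all checks are balanced, a condition insensitive
   to the duplication of checks.

   Around a check of a cover the ones are even in number, and summing over the
   fiber gives balance. Conversely, if a check is balanced, the copies (i, k),
   k < p_i, of its neighbors can be paired off so that paired copies have
   different i; attaching the two members of a pair to the same copy of the
   check, by suitable permutations, gives a cover and a codeword on it.

   Expanding the zeta function, all coefficients are nonnegative, and that of a
   monomial is nonzero iff the monomial is a product of monomials of
   backtrackless tailless cycles. Take p_i copies of each edge at x_i. A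
   backtrackless tailless cycle pairs off, at each vertex it visits, copies of
   different edges, whence balance. Conversely, balance gives such a pairing at
   each check, and the even degree gives one at each bit node; following the
   two pairings alternately decomposes all the copies into cycles.

   For a codeword c of C, p = c is balanced, so the lift of c, constant on the
   edges at each bit node, is a sum of edge-simple cycles. These are sums of
   simple ones: cut at a repeated vertex. *)

Require Import Defs.
From HB Require Import structures.
From mathcomp Require Import all_boot all_order all_algebra.
From mathcomp Require Import fingroup perm boolp.

Set Implicit Arguments.
Unset Strict Implicit.
Unset Printing Implicit Defensive.

Import GRing.Theory Num.Theory.
Local Open Scope ring_scope.

(** * Balanced weights and pairings *)

Definition balanced (T : finType) (P : pred T) (q : T -> nat) : Prop :=
  exists h, (\sum_(x | P x) q x = h.*2)%N /\ forall x, P x -> (q x <= h)%N.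

Lemma eq_balanced (T : finType) (P P' : pred T) (q : T -> nat) :
  P =1 P' -> balanced P q -> balanced P' q.
Proof.
move=> PP' [h [sum_q q_le]]; exists h; split; last by move=> x; rewrite -PP'; apply: q_le.
by rewrite -sum_q; apply: eq_bigl => x; rewrite PP'.
Qed.

(* The copies (x, k), k < q x, are listed in order; the [t]-th copy is paired
   with the copy at distance [h] from it, which lies in another block because
   no block is longer than [h]. *)
Section Opposite.
Variables (T : finType) (h : nat) (q : T -> nat).
Hypothesis sum_q : (\sum_x q x = h.*2)%N.
Hypothesis q_le : forall x, (q x <= h)%N.

Let sh := [seq q x | x <- enum T].

Definition copy_rank (x : T) (k : nat) : nat := flatten_index sh (enum_rank x) k.

Definition opposite (t : nat) : nat := if (t < h)%N then (t + h)%N else (t - h)%N.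

Lemma nth_block x : nth 0%N sh (enum_rank x) = q x.
Proof. by rewrite (nth_map x) ?nth_enum_rank // -cardE ltn_ord. Qed.

Lemma sumn_blocks : sumn sh = h.*2.
Proof. by rewrite sumnE big_map -sum_q big_enum. Qed.

Lemma copy_rank_inj x k y l : (k < q x)%N -> (l < q y)%N ->
  copy_rank x k = copy_rank y l -> x = y /\ k = l.
Proof.
rewrite -!nth_block => kx ly eq_rank.
have xy : x = y.
  apply/enum_rank_inj/val_inj.
  by rewrite /= -[LHS](flatten_indexKl kx) -[RHS](flatten_indexKl ly) [flatten_index _ _ k]eq_rank.
split=> //; move: eq_rank; rewrite xy /copy_rank /flatten_index.
exact: addnI.
Qed.

Lemma copy_rank_lt x k : (k < q x)%N -> (copy_rank x k < h.*2)%N.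
Proof. by rewrite -nth_block -sumn_blocks; apply: flatten_indexP. Qed.

Lemma copy_rank_onto t : (t < h.*2)%N ->
  exists x k, (k < q x)%N /\ copy_rank x k = t.
Proof.
rewrite -sumn_blocks => t_lt.
have lt_index : (reshape_index sh t < #|T|)%N.
  by have := reshape_indexP t_lt; rewrite size_map -cardE.
pose x := enum_val (Ordinal lt_index).
have xE : enum_rank x = reshape_index sh t :> nat by rewrite enum_valK.
exists x, (reshape_offset sh t); split; last by rewrite /copy_rank xE reshape_indexK.
by rewrite -nth_block xE; apply: reshape_offsetP.
Qed.

Lemma opposite_lt t : (t < h.*2)%N -> (opposite t < h.*2)%N.
Proof.
rewrite /opposite -addnn; case: (ltnP t h) => [t_h _ | h_t t_lt].
  by rewrite ltn_add2r.
by apply: leq_ltn_trans t_lt; apply: leq_subr.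
Qed.

Lemma oppositeK t : (t < h.*2)%N -> opposite (opposite t) = t.
Proof.
rewrite /opposite -addnn => t_lt; case: (ltnP t h) => [t_h | h_t].
  by rewrite ltnNge leq_addl /= addnK.
by rewrite -(ltn_add2r h) subnK // t_lt.
Qed.

Lemma copy_rank_opposite x k y l : (k < q x)%N -> (l < q y)%N ->
  copy_rank y l = opposite (copy_rank x k) -> y != x.
Proof.
move=> kx ly eq_rank; apply/eqP => yx; move: eq_rank ly; rewrite yx => eq_rank lx.
have k_h : (k < h)%N := leq_trans kx (q_le x).
have l_h : (l < h)%N := leq_trans lx (q_le x).
move: eq_rank; rewrite /opposite /copy_rank /flatten_index.
set b := sumn _; case: ltnP => [_ | h_bk] /eqP.
  by rewrite -addnA eqn_add2l => /eqP lE; rewrite lE ltnNge leq_addl in l_h.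
rewrite -(eqn_add2r h) subnK // -addnA eqn_add2l => /eqP kE.
by rewrite -kE ltnNge leq_addl in k_h.
Qed.

End Opposite.

(** Ranking the copies turns [opposite] into the involution [tau]. The common bound [N] places all
    copies in a finite type; [tau] is unconstrained at pairs that are not copies. *)
Lemma pairing_exists (T : finType) (N : nat) (q : T -> nat) :
  (forall x, q x <= N)%N -> balanced predT q ->
  exists tau : T * 'I_N -> T * 'I_N, forall x : T * 'I_N, (x.2 < q x.1)%N ->
    [/\ ((tau x).2 < q (tau x).1)%N, (tau x).1 != x.1 & tau (tau x) = x].
Proof.
move=> qN [h [sum_q q_le0]].
have q_le x : (q x <= h)%N by apply: q_le0.
pose rk (x : T * 'I_N) := copy_rank q x.1 x.2.
pose partner (x y : T * 'I_N) := (y.2 < q y.1)%N && (rk y == opposite h (rk x)).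
have partnerP (x : T * 'I_N) : (x.2 < q x.1)%N -> exists y, partner x y.
  move=> qx; have := opposite_lt (copy_rank_lt sum_q qx).
  case/(copy_rank_onto sum_q) => y [k [ky kE]].
  exists (y, Ordinal (leq_trans ky (qN y))).
  by rewrite /partner /rk /= ky kE eqxx.
(* At a genuine copy the default is never taken, by [partnerP]. *)
pose tau x := odflt x [pick y | partner x y].
have tauP (x : T * 'I_N) : (x.2 < q x.1)%N -> partner x (tau x).
  move=> qx; rewrite /tau; case: pickP => //= none.
  by have [y] := partnerP x qx; rewrite none.
exists tau => x qx; have /andP[qt /eqP rt] := tauP x qx.
split=> //; first exact: (copy_rank_opposite q_le qx qt).
have /andP[qtt /eqP rtt] := tauP _ qt.
move: rtt; rewrite rt oppositeK ?(copy_rank_lt sum_q) // => rtt.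
have [eq1 /val_inj eq2] := copy_rank_inj qtt qx rtt.
by rewrite [LHS]surjective_pairing eq1 eq2 -surjective_pairing.
Qed.

(** Pair off each fiber of [kappa] separately. The weight [qc c] vanishes off the fiber of [c], so
    partners stay in the fiber and the pairings glue to one involution. *)
Lemma pairing_fibers (T K : finType) (kappa : T -> K) (N : nat) (q : T -> nat) :
  (forall x, q x <= N)%N -> (forall c, balanced (fun x => kappa x == c) q) ->
  exists tau : T * 'I_N -> T * 'I_N, forall x : T * 'I_N, (x.2 < q x.1)%N ->
    [/\ ((tau x).2 < q (tau x).1)%N, kappa (tau x).1 = kappa x.1,
        (tau x).1 != x.1 & tau (tau x) = x].
Proof.
move=> qN bal.
pose qc c x := if kappa x == c then q x else 0%N.
have /fin_all_exists[tau tauP] (c : K) : exists tau : T * 'I_N -> T * 'I_N,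
    forall x : T * 'I_N, (x.2 < qc c x.1)%N ->
    [/\ ((tau x).2 < qc c (tau x).1)%N, (tau x).1 != x.1 & tau (tau x) = x].
  apply: pairing_exists => [x|]; first by rewrite /qc; case: ifP.
  have [h [sum_q q_le]] := bal c; exists h; split=> [|x _].
    by rewrite -sum_q [RHS]big_mkcond.
  by rewrite /qc; case: ifP => // /q_le.
exists (fun x => tau (kappa x.1) x) => x qx.
have [] := tauP (kappa x.1) x; first by rewrite /qc eqxx.
rewrite {1}/qc; case: eqP => // tx qt nt tt.
by split; rewrite ?tx.
Qed.

(** * Alternating walks of two involutions *)

Section AlternatingWalks.
Variables (X : finType) (sigma : bool -> X -> X).
Hypothesis sigmaK : forall b, involutive (sigma b).

(** Recording which involution comes next makes the alternation a single injective map, whose orbits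
    are cycles. *)
Definition alt_step (y : X * bool) : X * bool := (sigma y.2 y.1, ~~ y.2).

Lemma alt_step_inj : injective alt_step.
Proof.
move=> [x b] [y c] [/= eq_s /negb_inj eq_b]; move: eq_s; rewrite eq_b.
by move/(can_inj (sigmaK c)) ->.
Qed.

Lemma alt_stepK x b : alt_step (sigma b x, b) = (x, ~~ b).
Proof. by rewrite /alt_step /= sigmaK. Qed.

(* Undoing the first and the last step turns a walk from (x, b) to (x, ~~ b)
   into a walk of the same kind that is shorter by two. *)
Lemma alt_step_no_return k x b :
  (forall j c, sigma c (iter j alt_step (x, b)).1 != (iter j alt_step (x, b)).1) ->
  iter k alt_step (x, b) != (x, ~~ b).
Proof.
elim/ltn_ind: k x b => [[|[|k]]] IH x b nofix.
- by rewrite /= xpair_eqE eqxx; case: (b).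
- by rewrite /= /alt_step xpair_eqE eqxx andbT (nofix 0%N).
rewrite iterS -[(x, ~~ b)]alt_stepK (inj_eq alt_step_inj) iterSr.
have -> : alt_step (x, b) = (sigma b x, ~~ b) by [].
have := IH k _ (sigma b x) (~~ b); rewrite negbK; apply=> // j c.
by have := nofix j.+1 c; rewrite iterSr.
Qed.

Lemma alt_orbit_uniq (A : {set X}) x :
  (forall b y, y \in A -> sigma b y \in A) ->
  (forall b y, y \in A -> sigma b y != y) -> x \in A ->
  uniq [seq y.1 | y <- orbit alt_step (x, false)] /\
  {subset [seq y.1 | y <- orbit alt_step (x, false)] <= A}.
Proof.
move=> stable nofix xA.
have iterA j y : y.1 \in A -> (iter j alt_step y).1 \in A.
  by move=> yA; elim: j => //= j; apply: stable.
have orbA y : y \in orbit alt_step (x, false) -> y.1 \in A.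
  by rewrite -fconnect_orbit => /iter_findex <-; apply: iterA.
split; last by move=> _ /mapP[y yO ->]; apply: orbA.
rewrite map_inj_in_uniq ?orbit_uniq // => -[y b] [z c] yO zO /= yz.
move: zO; rewrite -{}yz => zO; congr pair; apply/eqP/contraT => neq_bc.
have cE : c = ~~ b by move: neq_bc; case: (b); case: (c).
move: zO; rewrite {}cE => zO.
have : fconnect alt_step (y, b) (y, ~~ b).
  apply: (@connect_trans _ _ (x, false)); last by rewrite fconnect_orbit.
  by rewrite (fconnect_sym alt_step_inj) fconnect_orbit.
move/iter_findex/eqP; rewrite (negbTE (alt_step_no_return _ _)) // => j d.
by apply: nofix; apply: iterA; apply: orbA yO.
Qed.

(** Induction on the size of [A]: remove the points of one orbit; what remains is again stable under
    both involutions. *)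
Lemma alt_walks (A : {set X}) :
  (forall b y, y \in A -> sigma b y \in A) ->
  (forall b y, y \in A -> sigma b y != y) ->
  exists L : seq (seq (X * bool)),
    (forall w, w \in L -> w <> [::] /\ fcycle alt_step w) /\
    perm_eq [seq y.1 | y <- flatten L] (enum A).
Proof.
have [n] := ubnP #|A|; elim: n A => // n IH A; rewrite ltnS => leAn stable nofix.
have [A0 | [x xA]] := set_0Vmem A.
  by exists [::]; split=> //; rewrite A0 enum_set0.
pose w := orbit alt_step (x, false).
have [w_uniq wA] := alt_orbit_uniq stable nofix xA.
pose W := [set y in [seq y.1 | y <- w]].
have WA : W \subset A by apply/subsetP=> y; rewrite inE; apply: wA.
have memW y b : (y, b) \in w -> y \in W.
  by move=> yw; rewrite inE; apply/mapP; exists (y, b).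
have stepw y : (alt_step y \in w) = (y \in w).
  by rewrite -!fconnect_orbit -(same_fconnect1_r alt_step_inj).
(* If [sigma b y] occurs on the orbit with flag [b], the next point is [y]; if it occurs with the
   other flag, the previous point is [y]. *)
have W_stable b y : (sigma b y \in W) -> y \in W.
  rewrite inE => /mapP[[z c] zw /= ?]; subst z.
  case: (eqVneq c b) => [? | neq]; first subst c.
    by apply: (memW _ (~~ b)); rewrite -alt_stepK stepw.
  apply: (memW _ b); rewrite -stepw /alt_step /=.
  by have <- : c = ~~ b by move: neq; case: (b); case: (c).
have [] := IH (A :\: W).
- apply: leq_trans leAn; apply: proper_card; rewrite properEneq subsetDl andbT.
  apply/eqP=> /setP/(_ x); rewrite in_setD xA (memW x false) //.
  by rewrite -fconnect_orbit.
- move=> b y /setDP[yA yW]; rewrite in_setD stable // andbT.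
  by apply: contra yW; apply: W_stable.
- by move=> b y /setDP[yA _]; apply: nofix.
move=> L [cycL permL]; exists (w :: L); split.
  move=> v /predU1P[-> | /cycL//]; split; last exact: cycle_orbit alt_step_inj _.
  by rewrite /w /orbit -orderSpred.
rewrite /= map_cat; apply: uniq_perm; last 1 first.
- move=> y; rewrite mem_cat (perm_mem permL) !mem_enum in_setD.
  have -> : (y \in [seq y.1 | y <- w]) = (y \in W) by rewrite inE.
  by case: (boolP (y \in W)) => //= /(subsetP WA) ->.
- rewrite cat_uniq w_uniq (perm_uniq permL) enum_uniq andbT.
  apply/hasPn=> y; rewrite (perm_mem permL) mem_enum inE => /andP[yW _].
  by rewrite inE in yW.
- exact: enum_uniq.
Qed.

End AlternatingWalks.

(** * The support of the edge zeta function *)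

(** Monomials being written additively, this says that [m] is a product, with repetitions allowed,
    of monomials in [A]. *)
Definition msum_of (E : finType) (A : monom E -> Prop) (m : monom E) : Prop :=
  exists L : seq (monom E), (forall a, a \in L -> A a) /\ m = \sum_(a <- L) a.

Section Support.
Variable E : finType.
Implicit Types (a m : monom E) (x y : mpseries int E) (A B : monom E -> Prop).

Lemma eq_msum_of A B m :
  (forall a, A a <-> B a) -> msum_of A m -> msum_of B m.
Proof. by move=> AB [L [LA ->]]; exists L; split=> // a /LA /AB. Qed.

Lemma msum_of_sum A (ms : seq (monom E)) :
  (forall m, m \in ms -> msum_of A m) -> msum_of A (\sum_(m <- ms) m).
Proof.
elim: ms => [_|m ms IH ms_A]; first by exists [::]; rewrite !big_nil.
have [L [LA ->]] := ms_A m (mem_head _ _).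
have [|L' [LA' sumL']] := IH; first by move=> m' m'ms; apply: ms_A; rewrite inE m'ms orbT.
exists (L ++ L'); split=> [a|]; first by rewrite mem_cat => /orP[/LA | /LA'].
by rewrite big_cons big_cat /= -sumL'.
Qed.

Lemma msum_of_mono A B m :
  (forall a, A a -> msum_of B a) -> msum_of A m -> msum_of B m.
Proof. by move=> AB [L [LA ->]]; apply: msum_of_sum => a /LA /AB. Qed.

(** Sorting the factors by membership in [A] gives a divisor [b] and its cofactor, the shape of a
    term in the convolution defining a product of series. *)
Lemma msum_ofU A B m :
  msum_of (fun a => A a \/ B a) m <->
  exists b, [/\ mdvd b m, msum_of A b & msum_of B (msub m b)].
Proof.
split=> [[L [LAB ->]] | [b [bm [L [LA bE]] [L' [LB mE]]]]]; last first.
  exists (L ++ L'); rewrite big_cat /= -bE -mE addrC msubK //; split=> // a.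
  by rewrite mem_cat => /orP[/LA | /LB]; [left | right].
set bA := \sum_(a <- L | `[< A a >]) a; set bN := \sum_(a <- L | ~~ `[< A a >]) a.
have -> : \sum_(a <- L) a = bA + bN by rewrite (bigID (fun a => `[< A a >])).
exists bA; rewrite mdvd_addl maddKl; split=> //.
  exists [seq a <- L | `[< A a >]]; rewrite big_filter; split=> // a.
  by rewrite mem_filter => /andP[/asboolP].
exists [seq a <- L | ~~ `[< A a >]]; rewrite big_filter; split=> // a.
by rewrite mem_filter => /andP[/asboolPn nA /LAB[]].
Qed.

(* Nonnegativity is carried along because it excludes cancellation in products. *)
Definition supported_by x A : Prop :=
  forall m, 0 <= x m /\ (x m <> 0 <-> msum_of A m).

Lemma eq_supported x A B :
  (forall a, A a <-> B a) -> supported_by x A -> supported_by x B.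
Proof.
move=> AB xA m; have [x_ge0 xAm] := xA m; split=> //; rewrite xAm.
by split; apply: eq_msum_of => a; rewrite AB.
Qed.

Lemma supported1 : supported_by 1 (fun=> False).
Proof.
move=> m; rewrite mps1E; split; first by case: eqP.
split=> [|[[|a L] [LF ->]]]; last by case: (LF a (mem_head _ _)).
  by case: eqP => // -> _; exists [::]; rewrite big_nil.
by rewrite big_nil eqxx.
Qed.

(** A sum of nonnegative terms is nonzero iff some term is, and a term is nonzero iff both of its
    factors are. *)
Lemma supportedM x y A B : supported_by x A -> supported_by y B ->
  supported_by (x * y) (fun a => A a \/ B a).
Proof.
move=> xA yB m; rewrite mpsME.
have term_ge0 a : 0 <= x a * y (msub m a).
  by apply: mulr_ge0; [case: (xA a) | case: (yB (msub m a))].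
split; first exact: sumr_ge0.
rewrite msum_ofU; split=> [/eqP | [b [bm Ab Bb]]].
  rewrite psumr_eq0 // => /allPn[a]; rewrite mem_mdivisors => am /=.
  rewrite mulf_eq0 negb_or => /andP[/eqP xa /eqP ya]; exists a.
  by split=> //; [case: (xA a) => _ <- | case: (yB (msub m a)) => _ <-].
apply/eqP; rewrite psumr_eq0 //; apply/allPn; exists b; rewrite ?mem_mdivisors //=.
rewrite mulf_eq0 negb_or; apply/andP; split; apply/eqP.
  by case: (xA b) => _ ->.
by case: (yB (msub m b)) => _ ->.
Qed.

(** Multiplying by [1 - mpsX int a] yields the recursion [xE]; induction on the degree then matches
    it with the multiples of [a]. *)
Lemma supported_geom a : a != 0 -> supported_by (1 - mpsX int a)^-1 (fun b => b = a).
Proof.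
move=> a_n0; set x := _^-1.
have xE m : x m = (m == 0)%:R + (if mdvd a m then x (msub m a) else 0).
  have : x * (1 - mpsX int a) = 1 by rewrite mulVr ?mps_geom_unit.
  rewrite mulrBr mulr1 => /(congr1 (fun z : mpseries int E => z m)).
  by rewrite mpsBE mpsMXE mps1E => <-; rewrite subrK.
have mX m : msum_of (fun b => b = a) m <-> exists k, m = a *+ k.
  split=> [[L [La ->]] | [k ->]].
    exists (size L); elim: L La => [|b L IH] La; first by rewrite big_nil.
    rewrite big_cons (La b) ?mem_head // IH ?mulrS // => c cL.
    by apply: La; rewrite inE cL orbT.
  exists (nseq k a); split; last by rewrite sumr_const_nat || rewrite big_nseq iter_addr_0.
  by move=> b /nseqP[].
move=> m; rewrite mX; have [d] := ubnP (mdegree m); elim: d m => // d IH m.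
rewrite ltnS xE => md; case: ifPn => am; last first.
  rewrite addr0; split; first by case: eqP.
  split=> [|[[|k] mE]]; [by case: eqP => // -> _; exists 0%N | by rewrite mE mulr0n eqxx |].
  by rewrite mE mulrS mdvd_addl in am.
have m_n0 : (m == 0) = false.
  by apply/negP=> /eqP m0; rewrite m0 mdvdn0 (negbTE a_n0) in am.
rewrite m_n0 add0r; have [] := IH (msub m a).
  apply: leq_trans md; rewrite -{2}(msubK am) mdegreeD -addn1 leq_add2l.
  by rewrite lt0n mdegree_eq0.
move=> x_ge0 ->; split=> //; split=> [[k mE] | [[|k] mE]].
- by exists k.+1; rewrite mulrSr -mE msubK.
- by rewrite mE eqxx in m_n0.
by exists k; rewrite mE mulrSr maddK.
Qed.

Lemma supported_prod (I : eqType) (r : seq I) (P : pred I)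
    (F : I -> mpseries int E) (A : I -> monom E -> Prop) :
  (forall i, P i -> supported_by (F i) (A i)) ->
  supported_by (\prod_(i <- r | P i) F i)
    (fun a => exists i, [/\ i \in r, P i & A i a]).
Proof.
move=> FA; elim: r => [|i r IH].
  by rewrite big_nil; apply: eq_supported supported1 => a; split=> // -[i []].
rewrite big_cons; case: ifPn => Pi; last first.
  apply: eq_supported IH => a; split=> -[j [jr Pj Aj]].
    by exists j; rewrite inE jr orbT.
  exists j; split=> //; move: jr; rewrite inE => /predU1P[ji|//].
  by rewrite ji (negbTE Pi) in Pj.
apply: eq_supported (supportedM (FA i Pi) IH) => a; split.
  case=> [Ai | [j [jr Pj Aj]]]; first by exists i; rewrite mem_head.
  by exists j; rewrite inE jr orbT.
case=> j [jr Pj Aj]; move: jr; rewrite inE => /predU1P[<-|jr]; first by left.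
by right; exists j.
Qed.

End Support.

Section ZetaSupport.
Variable G : sgraph.
Implicit Types s t : seq (edge G).

(** Unlike in [zeta_cycles], powers are allowed; their monomials are multiples of that of a
    primitive root, so the products of monomials are the same. *)
Definition tailless_cycle s : Prop :=
  [/\ is_cycle s, backtrackless s & tailless s].

(** Having no tail is having no backtrack at the closing point, so both conditions merge into one
    cyclic relation. *)
Lemma tailless_cycleE s : s <> [::] ->
  path.cycle (fun e e' => e != e') s = backtrackless s && tailless s.
Proof. by case: s => // e s _; rewrite /= rcons_path eq_sym. Qed.

Lemma cycle_monom_cat s t : cycle_monom (s ++ t) = cycle_monom s + cycle_monom t.
Proof. exact: big_cat. Qed.

Lemma cycle_monom_rot i s : cycle_monom (rot i s) = cycle_monom s.
Proof. by apply: perm_big; rewrite perm_rot. Qed.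

Lemma cycle_monom_flatten r s : cycle_monom (flatten (nseq r s)) = cycle_monom s *+ r.
Proof.
elim: r => [|r IH] /=; first by rewrite mulr0n /cycle_monom big_nil.
by rewrite cycle_monom_cat IH mulrS.
Qed.

(** A tail of [th] would be a backtrack at the junction of two successive copies of [th]. *)
Lemma tailless_cycle_root th r :
  is_cycle th -> (2 <= r)%N -> tailless_cycle (flatten (nseq r th)) -> tailless_cycle th.
Proof.
case: r => [|[|r]] //; case: th => [|e th]; first by case.
move=> cyc_th _ [_ /= bt _]; split=> //=.
  by move: bt; rewrite cat_path => /andP[].
by move: bt; rewrite cat_path /= eq_sym => /and3P[].
Qed.

(** Induction on the length: a cycle that is not primitive is a power of a strictly shorter one. *)
Lemma tailless_cycle_primitive_root s : tailless_cycle s ->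
  exists t k, [/\ tailless_cycle t, primitive t & cycle_monom s = cycle_monom t *+ k].
Proof.
have [d] := ubnP (size s); elim: d s => // d IH s; rewrite ltnS => sd tc_s.
have [prim | nprim] := pselect (primitive s).
  by exists s, 1%N.
have [th [r [cyc_th r_ge2 sE]]] :
    exists th r, [/\ is_cycle th, (2 <= r)%N & s = flatten (nseq r th)].
  by apply: contrapT.
have [] := IH th; last 1 first.
- move=> t [k [tc_t prim_t thE]]; exists t, (k * r)%N; split=> //.
  by rewrite sE cycle_monom_flatten thE mulrnA.
- apply: leq_trans sd; rewrite sE size_flatten /shape map_nseq sumn_nseq.
  by case: th cyc_th {sE} => [[]//|e th _]; rewrite ltn_Pmulr.
- by apply: (tailless_cycle_root cyc_th r_ge2); rewrite -sE.
Qed.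

Lemma cyclic_shift_equiv k :
  {in zeta_cycles G k & &, equivalence_rel (@cyclic_shift G k)}.
Proof.
(* Without the bound on [i] shifts compose freely. A rotation by [k] or more is the identity, that
   is, the rotation by 0, which is in range once [0 < k]. *)
have shiftP (s t : k.-tuple (edge G)) : (0 < k)%N ->
    reflect (exists i, rot i s = t :> seq _) (cyclic_shift s t).
  move=> k_gt0; apply: (iffP existsP) => [[i /eqP] | [i stE]]; first by exists i.
  have [lt_ik | le_ki] := ltnP i k; first by exists (Ordinal lt_ik); rewrite /= stE.
  by exists (Ordinal k_gt0); rewrite /= rot0 -stE rot_oversize // size_tuple.
move=> s t u; rewrite !inE => /asboolP[[s_nil _] _ _ _] _ _.
have k_gt0 : (0 < k)%N.
  by rewrite lt0n; apply: contra_notN s_nil => /eqP k0; apply/size0nil; rewrite size_tuple.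
split; first by apply/shiftP => //; exists 0%N; rewrite rot0.
move=> /(shiftP _ _ k_gt0)[i st]; apply/shiftP/shiftP => // -[j].
  have -> : tval s = rotr i t by rewrite -st rotK.
  by rewrite /rotr rot_rot_add; eexists; eassumption.
by rewrite -st rot_rot_add; eexists; eassumption.
Qed.

Lemma zeta_cyclesP k (t : k.-tuple (edge G)) :
  reflect (tailless_cycle t /\ primitive t) (t \in zeta_cycles G k).
Proof.
rewrite inE; apply: (iffP (asboolP _)) => [[cyc bt tl prim] | [[cyc bt tl] prim]] //.
Qed.

Lemma zeta_class_representative k (t : k.-tuple (edge G)) : t \in zeta_cycles G k ->
  exists2 t', t' \in transversal (zeta_classes G k) (zeta_cycles G k) &
    cycle_monom t' = cycle_monom t.
Proof.
move=> tZ; have partZ : partition (zeta_classes G k) (zeta_cycles G k) :=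
  equivalence_partitionP (@cyclic_shift_equiv k).
have tpb : t \in cover (zeta_classes G k) by rewrite (cover_partition partZ).
have pbP : pblock (zeta_classes G k) t \in zeta_classes G k by rewrite pblock_mem.
have trX := transversalP partZ.
have tX := repr_mem_transversal trX t pbP.
have tB := repr_mem_pblock trX t pbP.
set t' := transversal_repr _ _ _ in tX tB; exists t' => //.
have t'Z := subsetP (transversal_sub trX) _ tX.
move: tB; rewrite (pblock_equivalence_partition (@cyclic_shift_equiv k)) //.
by case/existsP=> i /eqP <-; rewrite cycle_monom_rot.
Qed.

Lemma edge_zeta_neq0 (m : monom (edge G)) :
  edge_zeta m <> 0 <->
  msum_of (fun a => exists2 s, tailless_cycle s & a = cycle_monom s) m.
Proof.
pose T k := transversal (zeta_classes G k) (zeta_cycles G k).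
have TP k (t : k.-tuple (edge G)) : t \in T k -> tailless_cycle t /\ primitive t.
  move=> tT; apply/zeta_cyclesP; move: tT; apply/subsetP/transversal_sub.
  exact/transversalP/equivalence_partitionP/cyclic_shift_equiv.
have monom_n0 k (t : k.-tuple (edge G)) : t \in T k -> cycle_monom t != 0.
  case/TP=> -[[t_nil _] _ _] _; rewrite -mdegree_eq0 mdegree_cycle_monom.
  by apply: contra_notN t_nil => /nilP.
have suppT k : supported_by (\prod_(t in T k) (1 - mpsX int (cycle_monom t))^-1)
    (fun a => exists t : k.-tuple (edge G),
       [/\ t \in index_enum _, t \in T k & a = cycle_monom t]).
  by apply: supported_prod => t tT; apply: supported_geom (monom_n0 k t tT).
have := supported_prod (index_enum 'I_(mdegree m).+1) (fun k _ => suppT k) (P := predT).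
move/(_ m) => [_]; rewrite -/(partial_zeta (mdegree m)) -/(edge_zeta m) => ->.
split=> [|[L [LA mE]]].
  apply: msum_of_mono => a [k [_ _ [t [_ tT ->]]]].
  exists [:: cycle_monom t]; rewrite big_seq1; split=> // b; rewrite inE => /eqP ->.
  by exists t => //; case: (TP k t tT).
rewrite [X in msum_of _ X]mE; apply: msum_of_sum => a aL; have [s tc_s aE] := LA a aL.
have [t0 [j [tc_t prim_t stE]]] := tailless_cycle_primitive_root tc_s.
(* The monomial of [t0] divides [m], so [t0] is short enough to have its class among the factors of
   the partial product. *)
have le_t : (0 < j -> size t0 <= mdegree m)%N.
  move=> j_gt0; rewrite -mdegree_cycle_monom; apply: mdvd_leq.
  rewrite mE (perm_big _ (perm_to_rem aL)) big_cons.
  apply: mdvd_trans (mdvd_addl _ _); rewrite aE stE -(prednK j_gt0) mulrS.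
  exact: mdvd_addl.
case: j => [|j] in stE le_t *; first by exists [::]; rewrite big_nil aE stE.
have tZ : in_tuple t0 \in zeta_cycles G (size t0) by apply/zeta_cyclesP.
have [t tT tE] := zeta_class_representative tZ.
exists (nseq j.+1 (cycle_monom t)); split=> [b /nseqP[-> _]|]; last first.
  by rewrite aE stE tE big_nseq iter_addr_0.
have lt_t : (size t0 < (mdegree m).+1)%N by rewrite ltnS le_t.
exists (Ordinal lt_t); split; rewrite ?mem_index_enum //.
by exists t; split; rewrite ?mem_index_enum.
Qed.

End ZetaSupport.

(** * Closed walks and the cycle code *)

Lemma balancedD (T : finType) (P : pred T) (q q' : T -> nat) :
  balanced P q -> balanced P q' -> balanced P (fun x => q x + q' x)%N.
Proof.
move=> [h [sum_q q_le]] [h' [sum_q' q'_le]]; exists (h + h')%N.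
split=> [|x Px]; first by rewrite big_split /= sum_q sum_q' doubleD.
by rewrite leq_add ?q_le ?q'_le.
Qed.

(** The value of [F] at an entry is that of [K] at its cyclic successor, and passing to the
    successor permutes the positions. *)
Lemma cycle_sum_shift (T : Type) (R : rel T) (F K : T -> nat) (z : seq T) :
  (forall x y, R x y -> F x = K y) -> path.cycle R z ->
  (\sum_(x <- z) F x = \sum_(x <- z) K x)%N.
Proof.
move=> FK; case: z => [|x z] /=; first by rewrite !big_nil.
have pathE y p : path R y p -> (\sum_(t <- belast y p) F t = \sum_(t <- p) K t)%N.
  elim: p y => [|t p IH] y /=; first by rewrite !big_nil.
  by case/andP=> /FK yt /IH pE; rewrite !big_cons yt pE.
move/pathE; rewrite belast_rcons big_rcons /= big_cons => ->.
by rewrite big_cons addnC.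
Qed.

Lemma cycle_sum_le (T : Type) (R : rel T) (F K B : T -> nat) (z : seq T) :
  (forall x y, R x y -> F x + K y <= B x)%N -> path.cycle R z ->
  (\sum_(x <- z) F x + \sum_(x <- z) K x <= \sum_(x <- z) B x)%N.
Proof.
move=> FKB; case: z => [|x z] /=; first by rewrite !big_nil.
have path_le y p : path R y p ->
    (\sum_(t <- belast y p) F t + \sum_(t <- p) K t <= \sum_(t <- belast y p) B t)%N.
  elim: p y => [|t p IH] y /=; first by rewrite !big_nil.
  by case/andP=> /FKB yt /IH p_le; rewrite !big_cons addnACA leq_add.
move/path_le; rewrite belast_rcons big_rcons /= => le_xz.
by apply: leq_trans le_xz; rewrite leq_add2l big_cons addnC.
Qed.

Lemma not_uniq_map_split (T : Type) (S : eqType) (g : T -> S) (z : seq T) :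
  ~~ uniq [seq g y | y <- z] ->
  exists z1 a z2 b z3, z = z1 ++ a :: z2 ++ b :: z3 /\ g a = g b.
Proof.
elim: z => //= a z IH; rewrite negb_and negbK => /orP[az | /IH].
  suff [z2 [b [z3 [-> ab]]]] : exists z2 b z3, z = z2 ++ b :: z3 /\ g a = g b.
    by exists [::], a, z2, b, z3.
  elim: z az {IH} => //= b z IH; rewrite inE => /predU1P[ab | /IH].
    by exists [::], b, z.
  by case=> z2 [c [z3 [-> ac]]]; exists (b :: z2), c, z3.
case=> z1 [c [z2 [b [z3 [-> cb]]]]].
by exists (a :: z1), c, z2, b, z3.
Qed.

Section ClosedWalks.
Variable G : sgraph.
Implicit Types (s : seq (edge G)) (z : seq (G * G * edge G)) (v : G).

(** Each entry carries an edge together with its direction, so that a walk can be cut and rotated as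
    a single sequence. *)
Definition closed_walk z : bool :=
  all (fun y => ends y.2 == [set y.1.1; y.1.2]) z &&
  path.cycle (fun y y' => y.1.2 == y'.1.1) z.

Lemma is_cycleP s :
  is_cycle s <-> s <> [::] /\ exists2 z, closed_walk z & s = [seq y.2 | y <- z].
Proof.
split=> -[s_nil].
  case=> ds [ds_s cyc]; split=> //; exists (zip ds s).
    have sz : size ds = size s by have := congr1 size ds_s; rewrite !size_map.
    apply/andP; split; last first.
      move: cyc; rewrite -{1}(@unzip1_zip _ _ ds s) ?sz //.
      by rewrite /unzip1 cycle_map; apply: sub_cycle.
    elim: ds s ds_s {s_nil cyc sz} => [|d ds IH] [|e s] //= [de /IH ->].
    by rewrite -de eqxx.
  have sz : size ds = size s by have := congr1 size ds_s; rewrite !size_map.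
  by rewrite -/unzip2 unzip2_zip ?sz.
case=> z /andP[zE cyc] sE; split=> //; exists [seq y.1 | y <- z]; split.
  rewrite sE /directs -!map_comp.
  by elim: z zE {cyc sE} => //= y z IH /andP[/eqP yE /IH ->]; rewrite yE.
by rewrite cycle_map; apply: sub_cycle cyc.
Qed.

Lemma ends_neq (e : edge G) v w : ends e = [set v; w] -> v != w.
Proof.
move=> eE; apply/eqP=> vw; have /existsP[a /existsP[b /andP[ab /eqP]]] : is_edge (ends e) := valP e.
rewrite eE -vw setUid => /setP abv.
have := abv a; have := abv b; rewrite !inE !eqxx orbT => /eqP bv /eqP av.
by rewrite av bv sadj_irr in ab.
Qed.

Lemma incidence (e : edge G) v w u : ends e = [set v; w] ->
  (u \in ends e) = ((v == u) + (w == u))%N :> nat.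
Proof.
move=> eE; have vw := ends_neq eE; rewrite eE !inE ![u == _]eq_sym.
case: (v =P u) => [<-|_]; last by case: (w == u).
by rewrite [w == v]eq_sym (negbTE vw).
Qed.

(** An edge at [v] is a departure from [v] or an arrival there, and along a closed walk arrivals are
    as many as departures. *)
Lemma closed_walk_incidence z v : closed_walk z ->
  (\sum_(y <- z) (v \in ends y.2) = (\sum_(y <- z) (y.1.1 == v)).*2)%N.
Proof.
case/andP=> /allP zE cyc.
rewrite (eq_big_seq (fun y => (y.1.1 == v) + (y.1.2 == v))%N) => [|y /zE /eqP yE]; last first.
  exact: incidence.
rewrite big_split /= -addnn; congr addn.
by apply: cycle_sum_shift cyc => x y /eqP ->.
Qed.

Lemma cycle_monomE s e : cycle_monom s e = count_mem e s.
Proof.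
rewrite /cycle_monom; elim: s => [|e' s IH]; first by rewrite big_nil ffunE.
by rewrite big_cons maddE IH ffunE eq_sym.
Qed.

Lemma sum_cycle_monom_incidence s v :
  (\sum_(e | v \in ends e) cycle_monom s e = \sum_(e <- s) (v \in ends e))%N.
Proof.
under eq_bigr do rewrite cycle_monomE -sum1_count big_mkcond.
rewrite exchange_big; apply: eq_bigr => e _ /=.
by rewrite -big_mkcondr big_mkcond (bigD1 e) //= eqxx andbT; case: ifP => _;
  rewrite big1 // => e' /negbTE; rewrite eq_sym => ->; rewrite andbF.
Qed.

(** Half the incidences at [v] is the number of passages through [v]. Arrival and departure of one
    passage use different edges, so a passage uses a given edge at most once. *)
Lemma tailless_cycle_balanced s v : tailless_cycle s ->
  balanced (fun e => v \in ends e) (cycle_monom s).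
Proof.
case=> /is_cycleP[s_nil [z cw sE]] bt tl.
have /andP[/allP zE cyc] := cw.
have : backtrackless s && tailless s by rewrite bt.
rewrite -tailless_cycleE // sE cycle_map => neq.
exists (\sum_(y <- z) (y.1.2 == v))%N; split=> [|e ve].
  rewrite sum_cycle_monom_incidence big_map closed_walk_incidence //.
  by congr double; apply/esym; apply: cycle_sum_shift cyc => x y /eqP ->.
rewrite cycle_monomE count_map -sum1_count big_mkcond /=.
(* The uses of [e] are split into arrivals at [v] and departures from [v], to be regrouped by
   passages with [cycle_sum_le]. *)
rewrite (eq_big_seq (fun y => ((y.2 == e) && (y.1.2 == v)) + ((y.2 == e) && (y.1.1 == v)))%N).
  rewrite big_split /=; apply: (@cycle_sum_le _
    (fun y y' => (y.1.2 == y'.1.1) && (y.2 != y'.2))); last first.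
    pose consec (y y' : G * G * edge G) := y.1.2 == y'.1.1.
    by rewrite (cycle_relI consec (fun y y' => y.2 != y'.2)) cyc.
  move=> x y /andP[/eqP <- nxy]; case: (x.1.2 == v); rewrite ?andbF // !andbT.
  case: (x.2 =P e) nxy => [-> | _ _]; last by case: (y.2 == e).
  by rewrite eq_sym => /negbTE ->.
move=> y /zE /eqP yE; case: eqP => //= ye; by rewrite addnC -(incidence v yE) ye ve.
Qed.

Lemma sum_charvec1 s e : (\sum_(e' <- s) charvec [set e']) e = (count_mem e s)%:R.
Proof.
elim: s => [|e' s IH]; first by rewrite big_nil ffunE.
by rewrite big_cons ffunE IH ffunE inE /= natrD eq_sym.
Qed.

Lemma closed_walk_cycle_code z : closed_walk z -> uniq [seq y.2 | y <- z] ->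
  \sum_(y <- z) charvec [set y.2] \in cycle_code G.
Proof.
have [d] := ubnP (size z); elim: d z => // d IH z; rewrite ltnS => zd cw uz.
have [-> | z_nil] := eqVneq z [::]; first by rewrite big_nil mem0v.
have [u1 | /not_uniq_map_split] := boolP (uniq [seq y.1.1 | y <- z]).
  (* With distinct initial vertices each vertex is left at most once, hence has at most two
     incidences: the cycle is simple. *)
  apply: memv_span; apply/mapP; exists [set e in [seq y.2 | y <- z]].
    rewrite mem_filter mem_enum andbT; apply/asboolP.
    exists [seq y.2 | y <- z]; split=> //; split=> // [|v].
      apply/is_cycleP; split; first by case: (z) z_nil.
      by exists z.
    rewrite -sum1_count big_mkcond big_map /= (closed_walk_incidence v cw).
    rewrite -[2%N]/(1.*2)%N leq_double.
    have := count_uniq_mem v u1; rewrite count_map -sum1_count big_mkcond /= => ->.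
    by case: (_ \in _).
  apply/ffunP=> e; rewrite -(big_map (fun y => y.2) xpredT (fun e => charvec [set e])).
  by rewrite sum_charvec1 ffunE inE count_uniq_mem.
case=> z1 [a [z2 [b [z3 [zE ab]]]]].
(* Both pieces start at the repeated vertex, and each ends where the other starts, so both are
   closed. *)
pose w1 := a :: z2; pose w2 := b :: z3 ++ z1.
have perm_z : perm_eq z (w1 ++ w2) by rewrite zE perm_catC /= -!catA.
have rotz : rot (size z1) z = w1 ++ w2 by rewrite zE rot_size_cat /= -!catA.
have [cw1 cw2] : closed_walk w1 /\ closed_walk w2.
  move: cw; rewrite /closed_walk (perm_all _ perm_z) all_cat.
  rewrite -(rot_cycle (size z1)) rotz => /andP[/andP[-> ->]].
  by rewrite /= rcons_cat cat_path /= !rcons_path ab => /and3P[-> -> /andP[-> ->]].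
have : uniq ([seq y.2 | y <- w1] ++ [seq y.2 | y <- w2]).
  by rewrite -map_cat -(perm_uniq (perm_map _ perm_z)).
rewrite cat_uniq => /and3P[u_w1 _ u_w2]; rewrite (perm_big _ perm_z) big_cat /=.
have := perm_size perm_z; rewrite size_cat => sz.
apply: memvD; apply: IH => //; apply: leq_trans zd; rewrite sz.
  by rewrite -addn1 leq_add2l.
by rewrite -add1n leq_add2r.
Qed.

Lemma cycle_edge_simple_code s : is_cycle s -> uniq s ->
  \sum_(e <- s) charvec [set e] \in cycle_code G.
Proof.
by move=> /is_cycleP[_ [z cw ->]] uz; rewrite big_map; apply: closed_walk_cycle_code.
Qed.

End ClosedWalks.

(** * Edge weights on a Tanner graph *)

Lemma F2_natr (x : 'F_2) : x = (x != 0)%:R.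
Proof. by case: x => [[|[|k]]] // ltk; apply: val_inj. Qed.

Lemma F2_eq1 (x : 'F_2) : (x == 1) = (x != 0).
Proof. by rewrite [x]F2_natr; case: (x != 0); rewrite ?eqxx ?oner_eq0 // eq_sym oner_eq0. Qed.

Lemma F2_natr_eq0 k : (k%:R == 0 :> 'F_2) = ~~ odd k.
Proof. by rewrite -(dvdn_pcharf (pchar_Fp (isT : prime 2))) dvdn2. Qed.

Lemma F2_sum (I : finType) (P : pred I) (F : I -> 'F_2) :
  (\sum_(i | P i) F i == 0) = ~~ odd (\sum_(i | P i) (F i != 0%R)).
Proof.
rewrite -F2_natr_eq0 natr_sum; congr (_ == 0).
by apply: eq_bigr => i _; rewrite -F2_natr.
Qed.

Lemma sum_ord_lt N k : (k <= N)%N -> (\sum_(i < N) (i < k))%N = k.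
Proof.
by move=> kN; rewrite -big_mkcond -(big_ord_widen _ (fun=> 1%N) kN) sum1_card card_ord.
Qed.

Section TannerEdges.
Variables (n r : nat) (H : 'M['F_2]_(r, n)).
Local Notation T := (tanner H).
Implicit Types (e : edge T) (i : 'I_n) (j : 'I_r) (p : 'I_n -> nat).

Lemma edge_exists_ends e : exists ij : 'I_n * 'I_r,
  (H ij.2 ij.1 == 1) && (ends e == [set inl ij.1; inr ij.2]).
Proof.
have /existsP[v /existsP[w /andP[vw eE]]] : is_edge (ends e) := valP e.
case: v w vw eE => [i|j] [i'|j'] //= Hij eE; first by exists (i, j'); rewrite Hij.
by exists (i', j); rewrite Hij setUC.
Qed.

Definition ebit e : 'I_n := (xchoose (edge_exists_ends e)).1.
Definition echk e : 'I_r := (xchoose (edge_exists_ends e)).2.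

Lemma echk_ebit e : H (echk e) (ebit e) == 1.
Proof. by case/andP: (xchooseP (edge_exists_ends e)). Qed.

Lemma endsE e : ends e = [set inl (ebit e); inr (echk e)].
Proof. by apply/eqP; case/andP: (xchooseP (edge_exists_ends e)). Qed.

Lemma bit_ends e i : ((inl i : T) \in ends e) = (ebit e == i).
Proof. by rewrite endsE !inE orbF eq_sym. Qed.

Lemma check_ends e j : ((inr j : T) \in ends e) = (echk e == j).
Proof. by rewrite endsE !inE eq_sym. Qed.

Lemma edge_eq e e' : ebit e = ebit e' -> echk e = echk e' -> e = e'.
Proof.
by move=> eb ec; apply: val_inj; suff : ends e = ends e' by []; rewrite !endsE eb ec.
Qed.

Lemma edge_of i j : H j i == 1 -> exists e, ebit e = i /\ echk e = j.
Proof.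
move=> Hji; have ed : is_edge [set (inl i : T); inr j].
  by apply/existsP; exists (inl i); apply/existsP; exists (inr j); rewrite /= Hji eqxx.
pose e : edge T := exist (fun d => is_edge d) _ ed; exists e.
by split; apply/eqP; [rewrite -bit_ends | rewrite -check_ends]; rewrite !inE eqxx ?orbT.
Qed.

Lemma sum_edges_at_check j p :
  (\sum_(e | echk e == j) p (ebit e) = \sum_(i | (H j i == 1)%R) p i)%N.
Proof.
rewrite (partition_big ebit (fun i => H j i == 1)) /=; last first.
  by move=> e /eqP <-; apply: echk_ebit.
apply: eq_bigr => i /edge_of[e [ei ej]].
rewrite (big_pred1 e) ?ei // => e' /=; apply/andP/eqP => [[/eqP e'j /eqP e'i] | ->].
  by apply: edge_eq; rewrite ?e'i ?e'j.
by rewrite ei ej.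
Qed.

Lemma sum_edges_at_bit i : (\sum_(e | ebit e == i) 1 = degree (bit_node H i))%N.
Proof.
rewrite /degree -sum1_card.
rewrite (partition_big (fun e => inr (echk e) : T) (mem (neighbors (bit_node H i)))) /=.
  apply: eq_bigr => -[i'|j]; rewrite inE //= => /edge_of[e [ei ej]].
  rewrite (big_pred1 e) // => e' /=; apply/andP/eqP => [[/eqP e'i /eqP[e'j]] | ->].
    by apply: edge_eq; rewrite ?e'i ?e'j.
  by rewrite ei ej.
by move=> e /eqP <-; rewrite inE /= echk_ebit.
Qed.

Definition check_balanced p : Prop :=
  forall j, balanced (fun i => H j i == 1) p.

(** Moves balance from bit nodes to edges, whose copies are what the pairings act on. *)
Lemma check_balancedE p :
  check_balanced p <-> forall j, balanced (fun e => echk e == j) (p \o ebit).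
Proof.
split=> bal j; have [h [sum_p p_le]] := bal j; exists h.
  split=> [|e /eqP ej]; first by rewrite -sum_p -sum_edges_at_check.
  by apply: p_le; rewrite -ej echk_ebit.
split=> [|i /edge_of[e [<- ej]]]; first by rewrite -sum_p -sum_edges_at_check.
by apply: p_le; rewrite ej.
Qed.

(** The [d] edges at bit [i] all have weight [p i], so half the sum is [p i * d./2]; an even [d] is
    at least 2 as soon as there is an edge. *)
Lemma bit_balanced p : bit_even H ->
  forall i, balanced (fun e => ebit e == i) (p \o ebit).
Proof.
move=> even i; have := even i.
rewrite -sum_edges_at_bit; set d := (\sum_(e | ebit e == i) 1)%N => even_d.
have sumE : (\sum_(e | ebit e == i) p (ebit e) = p i * d)%N.
  rewrite mulnC big_distrl /=.
  by apply: eq_bigr => e /eqP ->; rewrite mul1n.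
exists (p i * d./2)%N; split=> [|e /eqP ei].
  by rewrite /= sumE -[in LHS](even_halfK even_d) doubleMr.
rewrite /= ei leq_pmulr // half_gt0.
have : (0 < d)%N by rewrite /d (bigD1 e) ?ei.
by case: (d) even_d => [|[]].
Qed.

Definition edge_weights p : monom (edge T) := [ffun e => p (ebit e)].

Lemma edge_weights_cycles p : bit_even H -> check_balanced p ->
  msum_of (fun a => exists2 s, tailless_cycle s & a = cycle_monom s) (edge_weights p).
Proof.
move=> even /check_balancedE balC; have balB := bit_balanced p even.
pose N := (\max_i p i)%N.
have pN e : (p (ebit e) <= N)%N by apply: (leq_bigmax (ebit e)).
have [tauC tauCP] := pairing_fibers pN balC.
have [tauB tauBP] := pairing_fibers pN balB.
pose A := [set x : edge T * 'I_N | (x.2 < p (ebit x.1))%N].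
pose tau (b : bool) := if b then tauB else tauC.
have tauA b x : x \in A -> [/\ tau b x \in A, tau b (tau b x) = x, (tau b x).1 != x.1
    & if b then ebit (tau b x).1 = ebit x.1 else echk (tau b x).1 = echk x.1].
  by rewrite !inE; case: b => /= [/tauBP[] | /tauCP[]].
(* Extended by the identity outside the set [A] of genuine copies, the pairings become involutions
   of the whole type. *)
pose sigma b x := if x \in A then tau b x else x.
have sigmaA b x : x \in A -> sigma b x = tau b x by rewrite /sigma => ->.
have sigmaK b : involutive (sigma b).
  move=> x; rewrite {2}/sigma; case: ifPn => [xA | xA]; last by rewrite /sigma (negbTE xA).
  by have [tA tt _ _] := tauA b x xA; rewrite sigmaA.
have [||L [cycL permL]] := @alt_walks _ sigma sigmaK A.
- by move=> b x xA; rewrite sigmaA //; case: (tauA b x xA).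
- move=> b x xA; rewrite sigmaA //; case: (tauA b x xA) => _ _ + _.
  by apply: contra => /eqP ->.
pose walk (w : seq (edge T * 'I_N * bool)) := [seq y.1.1 | y <- w].
exists [seq cycle_monom (walk w) | w <- L]; split.
  move=> _ /mapP[w wL ->]; exists (walk w) => //.
  have [w_nil cyc_w] := cycL w wL.
  have walk_nil : walk w <> [::] by case: (w) w_nil.
  have wA : all (fun y => y.1 \in A) w.
    apply/allP=> y yw; rewrite -mem_enum -(perm_mem permL); apply: map_f.
    by apply/flattenP; exists w.
  (* An edge is directed towards the node at which the next pairing is applied: flag [true] stands
     for the bit node, [false] for the check node. *)
  pose dir (y : edge T * 'I_N * bool) : T * T :=
    if y.2 then (inr (echk y.1.1), inl (ebit y.1.1))
    else (inl (ebit y.1.1), inr (echk y.1.1)).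
  have : is_cycle (walk w).
    apply/is_cycleP; split=> //; exists [seq (dir y, y.1.1) | y <- w]; last first.
      by rewrite -map_comp.
    apply/andP; split.
      apply/allP=> _ /mapP[[x b] _ ->] /=.
      by rewrite endsE /dir; case: b => //=; rewrite setUC.
    rewrite cycle_map; apply: (sub_in_cycle _ wA) cyc_w => -[x b] [x' b'] /= xA _.
    move/eqP=> [<- <-]; rewrite sigmaA //; have [_ _ _] := tauA b x xA.
    by rewrite /dir; case: b {xA} => /= ->.
  have : path.cycle (fun e e' => e != e') (walk w).
    rewrite cycle_map; apply: (sub_in_cycle _ wA) cyc_w => -[x b] [x' b'] /= xA _.
    by move/eqP=> [<- _]; rewrite sigmaA // eq_sym; case: (tauA b x xA).
  by rewrite tailless_cycleE // => /andP[bt tl] cyc.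
rewrite big_map.
have -> : \sum_(w <- L) cycle_monom (walk w) = cycle_monom [seq x.1 | x <- enum A].
  rewrite [RHS]/cycle_monom big_map -(perm_big _ permL) big_map big_flatten.
  by apply: eq_bigr => w _; rewrite /cycle_monom big_map.
apply/ffunP=> e; rewrite cycle_monomE count_map ffunE -[LHS](sum_ord_lt (pN e)).
rewrite -sum1_count big_enum_cond [RHS]big_mkcond /=.
(* Counts the copies of [e] in [A], split over edges and copy numbers; only the edge [e] itself
   contributes. *)
pose F e' (k : 'I_N) := if ((e', k) \in A) && (e' == e) then 1%N else 0%N.
rewrite (eq_bigr (fun x => F x.1 x.2)) => [|[e' k] _] //.
rewrite -(pair_bigA _ F) /F /=.
rewrite (bigD1 e) //= [X in (_ + X)%N]big1 ?addn0 => [|e' /negbTE ->]; last first.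
  by rewrite big1 // => k _; rewrite andbF.
by apply: eq_bigr => k _; rewrite inE eqxx andbT; case: (k < _)%N.
Qed.

(** Balance at a check holds for each cycle and is preserved by sums. *)
Lemma cycles_edge_weights p :
  msum_of (fun a => exists2 s, tailless_cycle s & a = cycle_monom s) (edge_weights p) ->
  check_balanced p.
Proof.
case=> L [LC wE]; apply/check_balancedE => j.
suff [h [sum_h h_le]] : balanced (fun e => (inr j : T) \in ends e) (edge_weights p).
  exists h; split.
    by rewrite -sum_h; apply: eq_big => [e | e _]; rewrite ?check_ends // ffunE.
  by move=> e ej; have := h_le e; rewrite check_ends ffunE; apply.
rewrite wE; elim: L LC {wE} => [|a L IH] LC.
  exists 0%N; split=> [|e _]; last by rewrite big_nil ffunE.
  by rewrite big1 // => e _; rewrite big_nil ffunE.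
have [s tc_s aE] := LC a (mem_head _ _).
have [|h [sum_h h_le]] := balancedD (tailless_cycle_balanced (inr j : T) tc_s) (IH _).
  by move=> b bL; apply: LC; rewrite inE bL orbT.
exists h; split; first by rewrite -sum_h; apply: eq_bigr => e _; rewrite big_cons maddE aE.
by move=> e ej; rewrite big_cons maddE aE; apply: h_le.
Qed.

Lemma edge_zeta_check_balanced p : bit_even H ->
  edge_zeta (edge_weights p) <> 0 <-> check_balanced p.
Proof.
move=> even; rewrite edge_zeta_neq0; split; first exact: cycles_edge_weights.
exact: edge_weights_cycles.
Qed.

End TannerEdges.

(** Exponents at most 1 force every cycle of the decomposition to be edge-simple, so each of them
    contributes an element of the cycle code. *)
Lemma simple_msum_cycle_code (G : sgraph) (m : monom (edge G)) :
  msum_of (fun a => exists2 s, tailless_cycle s & a = cycle_monom s) m ->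
  (forall e, m e <= 1)%N -> [ffun e => (m e)%:R] \in cycle_code G.
Proof.
case=> L [LC]; elim: L m LC => [|a L IH] m LC ->; rewrite ?big_nil ?big_cons => le1.
  set v := (X in X \in _); suff -> : v = 0 by apply: mem0v.
  by apply/ffunP=> e; rewrite !ffunE.
have [s [cyc_s _ _] aE] := LC a (mem_head _ _).
have s_uniq : uniq s.
  apply/count_mem_uniq=> e; have := le1 e; rewrite maddE aE cycle_monomE.
  rewrite -has_pred1 has_count; case: (count_mem e s) => [|[|k]] //.
set m' := \sum_(b <- L) b in le1 *.
have -> : [ffun e => ((a + m')%R e)%:R] =
    \sum_(e <- s) charvec [set e] + [ffun e => (m' e)%:R] :> {ffun edge G -> ('F_2)^o}.
  apply/ffunP=> e; rewrite [LHS]ffunE [RHS]ffunE maddE natrD aE cycle_monomE.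
  by rewrite sum_charvec1 [in RHS]ffunE.
apply: memvD; first exact: cycle_edge_simple_code.
apply: IH => // [b bL|e]; first by apply: LC; rewrite inE bL orbT.
by apply: leq_trans (le1 e); rewrite maddE leq_addl.
Qed.

(** * Lifting codewords to the edges *)

Section CodewordLift.
Variables (n r : nat) (H : 'M['F_2]_(r, n)).
Local Notation T := (tanner H).

(** The parity check makes the number of ones around [j] even; if there is a one, half that number
    is at least 1. *)
Lemma codeword_check_balanced (c : 'rV['F_2]_n) :
  H *m c^T = 0 -> check_balanced H (fun i => (c 0 i != 0) : nat).
Proof.
move=> Hc j; pose S := (\sum_(i | (H j i == 1)%R) (c 0%R i != 0%R))%N.
have even_S : ~~ odd S.
  rewrite -F2_sum; apply/eqP.
  transitivity ((H *m c^T) j 0); last by rewrite Hc mxE.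
  rewrite mxE big_mkcond; apply: eq_bigr => i _; rewrite mxE F2_eq1 [H j i]F2_natr.
  by case: (H j i != 0); rewrite ?mul1r ?mul0r ?eqxx ?oner_eq0.
exists S./2; split=> [|i Hji]; first by rewrite even_halfK.
case: (boolP (c 0 i != 0)) => // ci.
have : (0 < S)%N by rewrite /S (bigD1 i) //= ci.
by case: (S) even_S => [|[]].
Qed.

Definition lift_codeword (c : 'rV['F_2]_n) : {ffun edge T -> ('F_2)^o} :=
  [ffun e => c 0 (ebit e)].

Lemma lift_codeword_is_linear : linear lift_codeword.
Proof. by move=> a c c'; apply/ffunP=> e; rewrite !ffunE !mxE. Qed.

HB.instance Definition _ := GRing.isLinear.Build _ _ _ _ lift_codeword lift_codeword_is_linear.

Lemma lift_codeword_cycle_code (c : 'rV['F_2]_n) : bit_even H ->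
  check_balanced H (fun i => (c 0 i != 0) : nat) -> lift_codeword c \in cycle_code T.
Proof.
move=> even /(edge_weights_cycles even)/simple_msum_cycle_code wC.
suff -> : lift_codeword c = [ffun e => (edge_weights H (fun i => c 0 i != 0) e)%:R].
  by apply: wC => e; rewrite ffunE; case: (_ != _).
by apply/ffunP=> e; rewrite !ffunE -F2_natr.
Qed.

End CodewordLift.

(** * Labelings of the edges by their bit nodes *)

Section BitLabelings.
Variables (n r : nat) (H : 'M['F_2]_(r, n)).
Local Notation T := (tanner H).

(** The label [(i, k)] goes to the edge from bit [i] to its [k]-th neighbor in the enumeration; in
    the absence of multiple edges the two ends determine the edge. *)
Lemma bit_labeling_exists : exists lab, @bit_labeling n r H lab.
Proof.
pose D := {i : 'I_n & 'I_(degree (bit_node H i))}.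
have checkP (ij : D) : exists j, enum_val (tagged ij) = inr j /\ H j (tag ij) == 1.
  by have := enum_valP (tagged ij); case: (enum_val _) => [i'|j]; rewrite inE //=; exists j.
have labP (ij : D) :
    exists e : edge T, ebit e = tag ij /\ enum_val (tagged ij) = inr (echk e).
  by have [j [-> /edge_of[e [ei ej]]]] := checkP ij; exists e; rewrite ei ej.
have /choice[lab labE] := labP.
exists (fun i j => lab (Tagged (fun i => 'I_(degree (bit_node H i))) j)).
split; last by move=> i j; have [eb _] := labE (Tagged _ j); rewrite bit_ends eb.
have labT ij : lab (Tagged (fun i => 'I_(degree (bit_node H i))) (tagged ij)) = lab ij.
  by case: ij.
apply: (eq_bij (f := lab)) => [|ij]; last by rewrite labT.
have lab_inj : injective lab.
  move=> ij ij' eq_lab; have [] := labE ij; have [] := labE ij'; rewrite eq_lab.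
  move: (lab ij') {eq_lab} => e; case: ij ij' => [i k] [i' k'] /= eb ek' eb' ek.
  have ii' : i = i' by rewrite -eb -eb'.
  case: i' / ii' k' ek' {eb} => k' ek'.
  by congr existT; apply: enum_val_inj; rewrite ek ek'.
have /choice[g gE] (e : edge T) : exists ij, lab ij = e.
  have memN : inr (echk e) \in neighbors (bit_node H (ebit e)).
    by rewrite inE /= echk_ebit.
  pose ij : D := Tagged (fun i => 'I_(degree (bit_node H i))) (enum_rank_in memN (inr (echk e))).
  exists ij; have [eb ek] := labE ij; apply: edge_eq; first by rewrite eb.
  by move: ek; rewrite /= enum_rankK_in // => -[].
by exists g => // ij; apply: lab_inj; rewrite gE.
Qed.

Lemma bit_labeling_weights lab (p : 'I_n -> nat) : @bit_labeling n r H lab ->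
  \sum_(i < n) \sum_(j < degree (bit_node H i)) mvar (lab i j) *+ p i = edge_weights H p.
Proof.
case=> lab_bij lab_ends; rewrite sig_big_dep /=.
pose F (e : edge T) : monom (edge T) := mvar e *+ p (ebit e).
transitivity (\sum_e F e).
  rewrite (reindex _ (onW_bij _ lab_bij)) /=; apply: eq_bigr => -[i j] _ /=.
  by rewrite /F; have /eqP -> : ebit (lab i j) == i by rewrite -bit_ends; apply: lab_ends.
apply/ffunP=> e; rewrite ffunE sum_ffunE (bigD1 e) //= big1 => [|e' ne'].
  by rewrite /F ffunMnE ffunE eqxx addr0; apply: natn.
by rewrite /F ffunMnE ffunE eq_sym (negbTE ne') mul0rn.
Qed.

End BitLabelings.

Lemma check_balanced_duplicate n r s (H : 'M['F_2]_(r, n)) (f : 'I_s -> 'I_r) p :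
  check_balanced (duplicate_checks H f) p <-> check_balanced H p.
Proof.
split=> bal j.
  by apply: eq_balanced (bal (lshift s j)) => i; rewrite col_mxEu.
case: (split_ordP j) => k ->.
  by apply: eq_balanced (bal k) => i; rewrite col_mxEu.
by apply: eq_balanced (bal (f k)) => i; rewrite col_mxEd !mxE.
Qed.

(** The subcode is the image of [C] under the lift, and one edge [phi i] is kept at each bit node;
    positive degree provides it, and its value is the [i]-th coordinate. *)
Lemma punctured_cycle_code n r s (C : {vspace 'rV['F_2]_n})
    (H : 'M['F_2]_(r, n)) (f : 'I_s -> 'I_r) :
  has_tanner_graph H C -> bit_even (duplicate_checks H f) ->
  (forall i, (0 < degree (bit_node (duplicate_checks H f) i))%N) ->
  punctured_subcode C (cycle_code (tanner (duplicate_checks H f))).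
Proof.
set H' := duplicate_checks H f => CH even deg.
have /fin_all_exists[phi phiE] (i : 'I_n) : exists e : edge (tanner H'), ebit e = i.
  have := deg i; rewrite card_gt0 => /set0Pn[[i'|j]]; rewrite inE //= => /edge_of[e [ei _]].
  by exists e.
exists (linfun (@lift_codeword _ _ H') @: C)%VS, phi; split.
- apply/subvP=> _ /memv_imgP[c cC ->]; rewrite lfunE /=.
  apply: lift_codeword_cycle_code => //; apply/check_balanced_duplicate.
  by apply: codeword_check_balanced; apply/CH.
- by move=> i i' /(congr1 (fun e => ebit e)); rewrite !phiE.
have rowE c : \row_i (lift_codeword H' c (phi i) : 'F_2) = c.
  by apply/rowP=> i; rewrite mxE ffunE phiE.
move=> c; split=> [cC | [_ /memv_imgP[c' c'C ->] ->]].
  exists (linfun (@lift_codeword _ _ H') c); first exact: memv_img.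
  by rewrite lfunE /= rowE.
by rewrite lfunE /= rowE.
Qed.

(** * Pseudo-codewords *)

Lemma sum_sub (T : finType) (P Q : pred T) (F : T -> nat) :
  (\sum_(x : {x | P x} | Q (sval x)) F (sval x) = \sum_(x | P x && Q x) F x)%N.
Proof.
rewrite [RHS](reindex_omap (fun x : {x | P x} => sval x) insub) /=.
  by apply: eq_bigl => x; rewrite (valP x) (valK x) eqxx andbT.
by move=> x /andP[Px _]; rewrite insubT.
Qed.

(** Induction on [s]: a transposition corrects the value at the new point, and injectivity keeps it
    from moving the earlier values. *)
Lemma perm_extending (T : finType) (g : T -> T) (s : seq T) :
  {in s &, injective g} -> uniq s -> exists pi : {perm T}, {in s, pi =1 g}.
Proof.
elim: s => [|x s IH] g_inj /=; first by exists 1%g.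
case/andP=> xs /IH[y z ys zs|pi piE]; first by apply: g_inj; rewrite inE ?ys ?zs orbT.
exists (pi * tperm (pi x) (g x))%g => y; rewrite inE permM => /predU1P[-> | ys].
  by rewrite tpermL.
have yx : y != x by apply: contraNneq xs => <-.
rewrite -(piE y ys) tpermD //; first by rewrite (inj_eq perm_inj) eq_sym.
rewrite piE //; apply: contraNneq yx => /g_inj -> //; first by rewrite mem_head.
by rewrite inE ys orbT.
Qed.

(** Each residue modulo [h] has just two representatives below [h.*2], and they differ by [h]. *)
Lemma mod_opposite h t t' : (t < h.*2)%N -> (t' < h.*2)%N ->
  t = t' %[mod h] -> t' = t \/ t' = opposite h t.
Proof.
move=> th t'h.
have modE u : (u < h.*2)%N -> (u %% h = if u < h then u else u - h)%N.
  rewrite -addnn; case: (ltnP u h) => [/modn_small -> // | hu u2h].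
  rewrite -{1}(subnK hu) modnDr modn_small //.
  by rewrite -(ltn_add2r h) subnK.
rewrite (modE t) // (modE t') // /opposite.
case: (ltnP t h) => [t_lt | t_ge]; case: (ltnP t' h) => [t'_lt | t'_ge] eq_t.
- by left.
- by right; rewrite eq_t subnK.
- by right.
by left; rewrite -(subnK t'_ge) -eq_t subnK.
Qed.

(* The pairs of opposite copies are numbered by the rank of their copies modulo
   [h]; the pairs numbered by [l] meet exactly two, distinct, indices [x]. *)
Lemma balanced_perms (T : finType) (P : pred T) (p : T -> nat) (M : nat) :
  balanced P p -> (\sum_x p x <= M)%N ->
  exists sigma : T -> {perm 'I_M}, forall l,
    ~~ odd (\sum_(x | P x) ((sigma x)^-1%g l < p x)).
Proof.
case=> h [sum_p p_le] pM.
pose q x := if P x then p x else 0%N.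
have sum_q : (\sum_x q x = h.*2)%N by rewrite -sum_p [RHS]big_mkcond.
have q_le x : (q x <= h)%N by rewrite /q; case: ifP => // /p_le.
have hM : (h <= M)%N.
  apply: leq_trans pM; apply: (@leq_trans h.*2); first by rewrite -addnn leq_addr.
  by rewrite -sum_p [X in (_ <= X)%N](bigID P) leq_addr.
have rk_lt x k : (k < q x)%N -> ((copy_rank q x k %% h)%N < M)%N.
  move=> kq; apply: leq_trans hM; rewrite ltn_mod.
  by apply: leq_trans (q_le x); apply: leq_ltn_trans kq.
pose g x (k : 'I_M) : 'I_M := odflt k (insub (copy_rank q x k %% h)%N).
have gE x (k : 'I_M) : (k < q x)%N -> g x k = (copy_rank q x k %% h)%N :> nat.
  by move=> kq; rewrite /g insubT ?rk_lt.
(* Copies with the same number are equal or opposite, and opposite copies have different indices. *)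
have g_inj x : {in enum [pred k : 'I_M | k < q x]%N &, injective (g x)}.
  move=> k k'; rewrite !mem_enum !inE => kq k'q /(congr1 val); rewrite /= !gE //.
  move=> eq_mod; have [] := mod_opposite (copy_rank_lt sum_q kq) (copy_rank_lt sum_q k'q) eq_mod.
    by case/(copy_rank_inj k'q kq) => _ /val_inj.
  by move/(copy_rank_opposite q_le kq k'q); rewrite eqxx.
have /choice[sigma sigmaE] x : exists pi : {perm 'I_M},
    {in enum [pred k : 'I_M | k < q x]%N, pi =1 g x}.
  by apply: perm_extending => //; apply: enum_uniq.
exists sigma => l.
have qP x : P x -> q x = p x by rewrite /q => ->.
(* The index [x] is counted at [l] iff one of its copies belongs to the pair numbered [l]. *)
have rowP x : P x -> reflect (exists2 k, (k < q x)%N & (copy_rank q x k %% h)%N = l)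
    ((sigma x)^-1%g l < p x)%N.
  move=> Px; rewrite -qP //; apply: (iffP idP) => [kq | [k kq kl]].
    exists ((sigma x)^-1%g l) => //.
    by rewrite -gE // -sigmaE ?permKV // mem_enum.
  have kM : (k < M)%N by apply: leq_trans kq (leq_trans (q_le x) hM).
  suff <- : sigma x (Ordinal kM) = l by rewrite permK.
  by rewrite sigmaE ?mem_enum //; apply: val_inj; rewrite /= gE.
(* Numbers from [h] on belong to no pair; for [l < h] the pair consists of the copies of ranks [l]
   and [l + h]. *)
have [hl | lh] := leqP h l.
  rewrite big1 // => x Px; apply/eqP; rewrite eqb0; apply/negP => /(rowP x Px)[k kq kl].
  have h_gt0 : (0 < h)%N by apply: leq_trans (q_le x); apply: leq_ltn_trans kq.
  by move: hl; rewrite -kl leqNgt ltn_pmod.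
have [x [k [kq kl]]] : exists x k, (k < q x)%N /\ copy_rank q x k = l.
  by apply: (copy_rank_onto sum_q); rewrite -addnn ltn_addr.
have [y [k' [k'q k'l]]] : exists y k, (k < q y)%N /\ copy_rank q y k = (l + h)%N.
  by apply: (copy_rank_onto sum_q); rewrite -addnn ltn_add2r.
have xP u i : (i < q u)%N -> P u by rewrite /q; case: ifP.
have xy : y != x.
  by apply: (copy_rank_opposite q_le kq k'q); rewrite k'l kl /opposite lh.
rewrite (eq_bigr (fun z => (z == x) + (z == y))%N) => [|z Pz].
  rewrite big_split /= -!big_mkcondr.
  rewrite (big_pred1 x) => [|z]; last first.
    by rewrite /=; case: eqP => [->|]; rewrite ?andbF ?(xP _ _ kq).
  by rewrite (big_pred1 y) => [//|z]; rewrite /=; case: eqP => [->|]; rewrite ?andbF ?(xP _ _ k'q).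
have [<- | nzx] := eqVneq x z.
  rewrite eq_sym (negbTE xy) addn0; apply/eqP; rewrite eqb1.
  by apply/rowP; [exact: xP kq | exists k => //; rewrite kl modn_small].
have [<- | nzy] := eqVneq y z.
  apply/eqP; rewrite eqb1; apply/rowP; [exact: xP k'q | exists k' => //].
  by rewrite k'l modnDr modn_small.
apply/eqP; rewrite eqb0; apply/negP => /(rowP z Pz)[i iq il].
have eq_mod : copy_rank q x k = copy_rank q z i %[mod h].
  by rewrite il kl modn_small.
case: (mod_opposite (copy_rank_lt sum_q kq) (copy_rank_lt sum_q iq) eq_mod).
  by case/(copy_rank_inj iq kq) => zx; rewrite zx eqxx in nzx.
rewrite kl /opposite lh -k'l => /(copy_rank_inj iq k'q)[zy].
by rewrite zy eqxx in nzy.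
Qed.

(** * Covers from permutation voltages *)

Section VoltageCover.
Variables (G : sgraph) (M : nat) (g : G -> G -> {perm 'I_M}).
Hypothesis gV : forall u v, g v u = ((g u v)^-1)%g.

(** The derived graph of a permutation voltage assignment; [gV] makes the two directions of an edge
    define the same matching of fibers. *)
Definition voltage_adj : rel (G * 'I_M) := fun x y =>
  sadj x.1 y.1 && (y.2 == g x.1 y.1 x.2).

Lemma voltage_adj_sym : symmetric voltage_adj.
Proof.
move=> [u k] [v l]; rewrite /voltage_adj /= sadj_sym gV; congr (_ && _).
by rewrite -(inj_eq (@perm_inj _ (g v u))) permKV eq_sym.
Qed.

Lemma voltage_adj_irr : irreflexive voltage_adj.
Proof. by move=> x; rewrite /voltage_adj sadj_irr. Qed.

Definition voltage_cover : sgraph := SGraph voltage_adj_sym voltage_adj_irr.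

Definition voltage_proj (x : voltage_cover) : G := x.1.

Lemma voltage_Mcover : (0 < M)%N -> is_Mcover M voltage_proj.
Proof.
move=> M_gt0; split; last first.
  move=> v; rewrite -[RHS](card_ord M) -[RHS](card_imset _ (f := fun k => (v, k))).
    apply: eq_card => -[u k]; rewrite inE /voltage_proj /=.
    by apply/eqP/imsetP => [-> | [l _ [-> _]]] //; exists k.
  by move=> k l [].
split.
- by move=> v; exists (v, Ordinal M_gt0).
- by move=> x y /andP[].
move=> [u k]; split.
  move=> [v l] [w l']; rewrite !inE /voltage_proj /= /voltage_adj /=.
  by case/andP=> _ /eqP -> /andP[_ /eqP ->] ->.
apply/setP=> v; rewrite !inE; apply/imsetP/idP => [[[w l]] | uv].
  by rewrite inE => /andP[uw _] ->.
by exists (v, g u v k); rewrite // inE /= /voltage_adj /= uv eqxx.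
Qed.

End VoltageCover.

Section PseudocodewordBalance.
Variables (n r : nat) (H : 'M['F_2]_(r, n)).
Local Notation T := (tanner H).

Lemma sum_check_neighbors (j : 'I_r) (F : T -> nat) :
  (\sum_(v | sadj (inr j : T) v) F v = \sum_(i | (H j i == 1)%R) F (inl i))%N.
Proof. by rewrite big_sumType /= [X in (_ + X)%N]big_pred0_eq addn0. Qed.

Lemma cover_lift_count (Tt : sgraph) (pi : Tt -> T) (x : Tt) (v : T) :
  is_cover pi -> sadj (pi x) v -> (\sum_(y | sadj x y && (pi y == v)) 1 = 1)%N.
Proof.
case=> _ _ /(_ x)[pi_inj pi_im] xv.
have : v \in pi @: neighbors x by rewrite pi_im inE.
case/imsetP=> y; rewrite inE => xy ->; rewrite (big_pred1 y) // => z.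
apply/andP/eqP => [[xz /eqP zy] | ->]; last by rewrite xy eqxx.
by apply: pi_inj; rewrite ?inE.
Qed.

(** Each node [f] over check [j] sees an even number [N f] of ones, at most one of them over a given
    bit [i]. Half the total of the [N f] is therefore the bound [h]. *)
Lemma pseudocodeword_check_balanced (p : 'I_n -> nat) :
  unscaled_pseudocodeword H p -> check_balanced H p.
Proof.
case=> M [Tt [pi [a [_ [pi_cover _] a_code pE]]]] j.
have [_ pi_hom _] := pi_cover.
(* The assignment as a 0/1 weight on all nodes, zero over the checks. *)
pose av (x : Tt) : nat := if insub x is Some y then a y != 0 else 0%N.
have avE (x : bit_over pi) : av (sval x) = (a x != 0) by rewrite /av valK.
have av_le1 x : (av x <= 1)%N by rewrite /av; case: insub => // y; case: (_ != _).
have pE' i : p i = (\sum_(x | pi x == (inl i : T)) av x)%N.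
  rewrite pE -sum1dep_card big_mkcondr /=.
  transitivity (\sum_(x : bit_over pi | pi (sval x) == (inl i : T)) av (sval x))%N.
    by apply: eq_bigr => x _; rewrite avE; case: (_ != _).
  rewrite (sum_sub _ (fun x => pi x == (inl i : T)) av).
  by apply: eq_bigl => x; case: eqP => [->|]; rewrite ?andbF.
pose N f := (\sum_(x | sadj f x) av x)%N.
have even_N f : pi f = inr j -> ~~ odd (N f).
  move=> fj; have : \sum_(x : bit_over pi | sadj f (sval x)) a x = 0.
    by apply: a_code; rewrite fj.
  move/eqP; rewrite F2_sum (eq_bigr (fun x => av (sval x))) => [|x _]; last by rewrite avE.
  rewrite (sum_sub _ (fun x => sadj f x) av) /N.
  congr (~~ odd _); apply: eq_bigl => x; apply: andb_idl => /pi_hom.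
  by rewrite fj; case: (pi x).
(* Every node over [i] has exactly one neighbor over [j], so the ones over [i] may be counted from
   the nodes over [j]. *)
have p_sum i : H j i == 1 ->
    p i = (\sum_(f | pi f == (inr j : T)) \sum_(x | sadj f x && (pi x == (inl i : T))) av x)%N.
  move=> Hji; rewrite pE' (exchange_big_dep (fun x => pi x == (inl i : T))) /=; last first.
    by move=> f x _ /andP[].
  apply: eq_bigr => x /eqP xi.
  rewrite -[LHS]muln1 -(@cover_lift_count _ pi x (inr j)) // ?xi // big_distrr /=.
  apply: eq_big => [f|f _]; last by rewrite muln1.
  by rewrite eqxx andbT sadj_sym andbC.
exists (\sum_(f | pi f == (inr j : T)) (N f)./2)%N; split=> [|i Hji].
  rewrite (eq_bigr _ p_sum) exchange_big /= -mul2n big_distrr /=.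
  apply: eq_bigr => f /eqP fj; rewrite mul2n even_halfK ?even_N //.
  rewrite -(sum_check_neighbors j (fun v => \sum_(x | sadj f x && (pi x == v)) av x)%N).
  by rewrite [RHS](partition_big pi (fun v => sadj (inr j : T) v)) // => x /pi_hom; rewrite fj.
rewrite (p_sum i Hji); apply: leq_sum => f /eqP fj.
set k := (\sum_(x | _) _)%N.
have k_le1 : (k <= 1)%N.
  rewrite -(@cover_lift_count _ pi f (inl i)) ?fj //.
  by apply: leq_sum => x _.
have k_leN : (k <= N f)%N.
  by rewrite /N (bigID (fun x => pi x == (inl i : T))) leq_addr.
(* If [k] is 1, then [N f] is positive and even, hence at least 2. *)
by case: k k_le1 k_leN => [|[]] // _; have := even_N f fj; case: (N f) => [|[]].
Qed.

(** The permutations of [balanced_perms], chosen for each check independently, serve as voltages,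
    and the ones are put on the copies [k < p i]. *)
Lemma check_balanced_pseudocodeword (p : 'I_n -> nat) :
  check_balanced H p -> unscaled_pseudocodeword H p.
Proof.
(* The successor makes [M] positive even for zero [p]. *)
move=> bal; pose M := (\sum_i p i).+1.
have pM : (\sum_i p i <= M)%N by apply: leqnSn.
have piM i : (p i <= M)%N by apply: leq_trans pM; rewrite (bigD1 i) //= leq_addr.
have /fin_all_exists[sigma sigmaE] j := balanced_perms (bal j) pM.
pose g (u v : T) : {perm 'I_M} :=
  match u, v with
  | inl i, inr j => sigma j i
  | inr j, inl i => ((sigma j i)^-1)%g
  | _, _ => 1%g
  end.
have gV u v : g v u = ((g u v)^-1)%g by case: u v => [i|j] [i'|j'] /=; rewrite ?invg1 ?invgK.
pose Tt := voltage_cover gV; pose pi : Tt -> T := @voltage_proj _ _ _ gV.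
pose one (x : Tt) : bool := if x.1 is inl i then (x.2 < p i)%N else false.
pose a : {ffun bit_over pi -> 'F_2} := [ffun x => (one (sval x))%:R].
have aE x : (a x != 0) = one (sval x) by rewrite ffunE; case: (one _); rewrite ?oner_eq0 ?eqxx.
exists M, Tt, pi, a; split=> //; first exact: voltage_Mcover.
  move=> [[i|j] l] //= _; apply/eqP; rewrite F2_sum.
  under eq_bigr do rewrite aE.
  rewrite (sum_sub _ (fun x => sadj ((inr j, l) : Tt) x) (fun x => one x : nat)).
  (* The neighbor over bit [i] of the [l]-th copy of check [j] is copy [(sigma j i)^-1 l], so the
     ones around it are counted as in [balanced_perms]. *)
  rewrite (reindex_omap (fun i => (inl i, ((sigma j i)^-1)%g l) : Tt)
                        (fun x : Tt => if x.1 is inl i then Some i else None)) /=.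
    rewrite (eq_bigl (fun i => H j i == 1)) => [|i]; first exact: sigmaE.
    by rewrite /voltage_adj /= !eqxx !andbT.
  by move=> [[i|j'] k] //= /andP[_ /eqP /= ->].
move=> i; rewrite -sum1dep_card big_mkcondr /=.
transitivity (\sum_(x : bit_over pi | pi (sval x) == bit_node H i) one (sval x))%N; last first.
  by apply: eq_bigr => x _; rewrite aE; case: (one _).
rewrite (sum_sub _ (fun x => pi x == bit_node H i) (fun x => one x : nat)).
rewrite (reindex_omap (fun k => (inl i, k) : Tt)
                      (fun x : Tt => if x.1 == (inl i : T) then Some x.2 else None)) /=.
  rewrite -[LHS](sum_ord_lt (piM i)); apply: eq_big => [k|//].
  by rewrite /pi /voltage_proj /= !eqxx.
by move=> [[i'|j'] k] //= /eqP[->]; rewrite eqxx.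
Qed.

Lemma unscaled_pseudocodewordE (p : 'I_n -> nat) :
  unscaled_pseudocodeword H p <-> check_balanced H p.
Proof.
by split; [apply: pseudocodeword_check_balanced | apply: check_balanced_pseudocodeword].
Qed.

End PseudocodewordBalance.

Theorem theorem6p4 (n r s : nat) (C : {vspace 'rV['F_2]_n})
    (H : 'M['F_2]_(r, n)) (f : 'I_s -> 'I_r)
    (CH : has_tanner_graph H C)
    (even_That : bit_even (duplicate_checks H f)) :
  ((forall i, (0 < degree (bit_node (duplicate_checks H f) i))%N) ->
     punctured_subcode C (cycle_code (tanner (duplicate_checks H f))))
  /\
  (exists lab, @bit_labeling n (r + s) (duplicate_checks H f) lab)
  /\
  forall lab, @bit_labeling n (r + s) (duplicate_checks H f) lab ->
    forall p : 'I_n -> nat,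
      unscaled_pseudocodeword H p <->
      edge_zeta (\sum_(i < n)
                   \sum_(j < degree (bit_node (duplicate_checks H f) i))
                     mvar (lab i j) *+ p i) <> 0.
Proof.
split; first exact: punctured_cycle_code.
split=> [|lab labP p]; first exact: bit_labeling_exists.
rewrite bit_labeling_weights // edge_zeta_check_balanced //.
by rewrite unscaled_pseudocodewordE check_balanced_duplicate.
Qed.
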